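(* There is an absolute constant $C>0$ such that for every symmetric space $E$ on $I=[0,1]$, with $p=1/\alpha_E$, where $\alpha_E$ is the lower Boyd index of $E$ (and $p=\infty$ if $\alpha_E=0$), one has $$M(E)\subset L_p(I),\qquad \|x\|_{L_p}\le C\|x\|_{M(E)}\quad\text{for all }x\in M(E).$$
   Context: $I=[0,1]$ with Lebesgue measure $\mu$. For a measurable function $z$ on $I$ or $I\times I$, $n_z(\tau)=\mu\{w:|z(w)|>\tau\}$ ($\tau>0$) is the distribution function of $|z|$ (on $I\times I$, $\mu$ is two-dimensional Lebesgue measure); two functions are equimeasurable if their distribution functions coincide; $z^*$ is the left-continuous non-increasing rearrangement of $|z|$ on $(0,1]$. A symmetric space on $I$ is a nonzero Banach space $E$ of (classes of) measurable functions on $I$ such that: (a) $y\in E$ and $|x|\le|y|$ a.e. imply $x\in E$ and $\|x\|_E\le\|y\|_E$; (b) $y\in E$ and $x$ equimeasurable with $y$ imply $x\in E$ and $\|x\|_E=\|y\|_E$. $E(I\times I)$ denotes the space of measurable $z$ on $I\times I$ with $z^*\in E$, normed by $\|z\|_{E(I\times I)}=\|z^*\|_E$. For measurable $x,y$ on $I$, $(x\otimes y)(s,t)=x(s)y(t)$. The multiplicator $M(E)$ is the set of all measurable $x$ on $I$ such that $x\otimes y\in E(I\times I)$ for every $y\in E$, with norm $\|x\|_{M(E)}=\sup\{\|x\otimes y\|_{E(I\times I)}:\|y\|_E\le1\}$. For $t>0$ the dilation operator is $\sigma_t y(u)=y(u/t)\chi_{[0,1]}(u/t)$, $u\in I$.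 The lower Boyd index of $E$ is $\alpha_E=\lim_{t\to0+}\frac{\ln\|\sigma_t\|_{E\to E}}{\ln t}\in[0,1]$. *)

(* Defs.v *)
From HB Require Import structures.
From mathcomp Require Import all_boot all_order all_algebra.
From mathcomp Require Import all_classical all_reals all_analysis.

Set Implicit Arguments.
Unset Strict Implicit.
Unset Printing Implicit Defensive.

Import Order.TTheory GRing.Theory Num.Theory.
Import numFieldNormedType.Exports.

Local Open Scope classical_set_scope.
Local Open Scope ring_scope.

(* Classes of measurable functions on I = [0, 1] are represented by functions
   R -> R that are (Borel) measurable on I; values outside I are irrelevant.
   Functions on I x I are treated in the same way. *)

Definition unit_itv (R : realType) : set R := `[0, 1]%classic.
Arguments unit_itv R : clear implicits.

Definition unit_square (R : realType) : set (R * R) :=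
  unit_itv R `*` unit_itv R.
Arguments unit_square R : clear implicits.

Definition distr_fun d (T : measurableType d) (R : realType)
    (m : set T -> \bar R) (D : set T) (z : T -> R) (tau : R) : \bar R :=
  m (D `&` [set w | tau < `|z w|]).

Definition distr1 (R : realType) (x : R -> R) : R -> \bar R :=
  distr_fun (@lebesgue_measure R) (unit_itv R) x.

Definition distr2 (R : realType) (z : R * R -> R) : R -> \bar R :=
  distr_fun (@lebesgue_measure R \x @lebesgue_measure R)%E (unit_square R) z.

Definition equimeasurable (R : realType) (x y : R -> R) : Prop :=
  forall tau : R, 0 < tau -> distr1 x tau = distr1 y tau.

(* The strict inequality n tau < t selects the left-continuous version. *)
Definition rearr (R : realType) (n : R -> \bar R) (t : R) : R :=
  inf [set tau : R | 0 < tau /\ (n tau < t%:E)%E].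

Definition rearr2 (R : realType) (z : R * R -> R) : R -> R :=
  rearr (distr2 z).

(* norm_sp is meaningful on mem_sp only. Invariance of membership and norm
   under a.e. equality on I is a special case of sp_ideal, so this is a Banach
   space of classes. *)
Record symmetric_space (R : realType) := SymmetricSpace {
  mem_sp : set (R -> R) ;
  norm_sp : (R -> R) -> R ;
  sp_measurable : forall x, mem_sp x -> measurable_fun (unit_itv R) x ;
  sp_add : forall x y, mem_sp x -> mem_sp y -> mem_sp (x \+ y) ;
  sp_scale : forall (a : R) x, mem_sp x -> mem_sp (fun u => a * x u) ;
  sp_nonzero : exists2 x, mem_sp x &
    ~ {ae lebesgue_measure, forall u, unit_itv R u -> x u = 0} ;
  norm_sp_ge0 : forall x, mem_sp x -> 0 <= norm_sp x ;
  norm_sp_eq0 : forall x, mem_sp x -> norm_sp x = 0 ->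
    {ae lebesgue_measure, forall u, unit_itv R u -> x u = 0} ;
  norm_spD : forall x y, mem_sp x -> mem_sp y ->
    norm_sp (x \+ y) <= norm_sp x + norm_sp y ;
  norm_spZ : forall (a : R) x, mem_sp x ->
    norm_sp (fun u => a * x u) = `|a| * norm_sp x ;
  sp_complete : forall f : nat -> R -> R, (forall n, mem_sp (f n)) ->
    (forall eps : R, 0 < eps -> exists N : nat, forall n m : nat,
      (N <= n)%N -> (N <= m)%N -> norm_sp (f n \- f m) < eps) ->
    exists2 x, mem_sp x & norm_sp (f n \- x) @[n --> \oo] --> (0 : R) ;
  sp_ideal : forall x y : R -> R, measurable_fun (unit_itv R) x -> mem_sp y ->
    {ae lebesgue_measure, forall u, unit_itv R u -> `|x u| <= `|y u|} ->
    mem_sp x /\ norm_sp x <= norm_sp y ;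
  sp_symmetric : forall x y : R -> R, measurable_fun (unit_itv R) x -> mem_sp y ->
    equimeasurable x y -> mem_sp x /\ norm_sp x = norm_sp y
}.

Definition mem_sp2 (R : realType) (E : symmetric_space R) (z : R * R -> R) :
    Prop :=
  measurable_fun (unit_square R) z /\ mem_sp E (rearr2 z).

Definition norm_sp2 (R : realType) (E : symmetric_space R) (z : R * R -> R) :
    R :=
  norm_sp E (rearr2 z).

Definition tensor (R : realType) (x y : R -> R) (w : R * R) : R :=
  x w.1 * y w.2.

Definition multiplicator (R : realType) (E : symmetric_space R) :
    set (R -> R) :=
  [set x | measurable_fun (unit_itv R) x /\
           forall y, mem_sp E y -> mem_sp2 E (tensor x y)].

(* Extended-real, since finiteness of the supremum is not part of the
   definition of M(E). *)
Definition norm_mult (R : realType) (E : symmetric_space R) (x : R -> R) :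
    \bar R :=
  ereal_sup [set (norm_sp2 E (tensor x y))%:E | y in
              [set y | mem_sp E y /\ norm_sp E y <= 1]].

Definition dilation (R : realType) (t : R) (y : R -> R) (u : R) : R :=
  y (u / t) * \1_(unit_itv R) (u / t).

Definition dilation_norm (R : realType) (E : symmetric_space R) (t : R) : R :=
  sup [set norm_sp E (dilation t y) | y in
        [set y | mem_sp E y /\ norm_sp E y <= 1]].

Definition lower_boyd (R : realType) (E : symmetric_space R) : R :=
  lim (ln (dilation_norm E t) / ln t @[t --> 0^'+]).

Definition boyd_exponent (R : realType) (E : symmetric_space R) : \bar R :=
  if lower_boyd E == 0 then +oo%E else ((lower_boyd E)^-1)%:E.

(* Zero extension, so that L_p(I) is read inside L_p(R). *)
Definition zero_ext (R : realType) (x : R -> R) (u : R) : R :=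
  x u * \1_(unit_itv R) u.

Definition Lp_unit (R : realType) (p : \bar R) : set (R -> R) :=
  [set x | zero_ext x \in Lfun (@lebesgue_measure R) p].

Definition Lp_unit_norm (R : realType) (p : \bar R) (x : R -> R) : \bar R :=
  Lnorm (@lebesgue_measure R) p (EFin \o zero_ext x).

(* Main.v *)
(* Put m = |x|_{M(E)}, which is finite by a gliding hump argument. Iterating
   y |-> (x (x) y)^* gives |(x^{(x) n} (x) y)^*|_E <= m^n |y|_E. If |x| >= c 2^j
   on disjoint sets A_j of measure t_j (j < d) and Q = sum_j t_j X^j, then
   x^{(x) n} is at least c^n 2^l on a set of measure q = (Q^n)_l, so the left-hand
   side is at least c^n 2^l |sigma_q y|_E. Since |sigma_q| >= q^alpha by
   submultiplicativity (Fekete), c^n 2^l q^alpha <= m^n. With p = 1 / alpha,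
   raising to the power p and summing over the at most d n + 1 values of l gives
   (sum_j (c 2^j)^p t_j)^n <= (d n + 1) m^{p n}, and the polynomial factor
   disappears as n tends to infinity: sum_j (c 2^j)^p t_j <= m^p. Taking for A_j
   the dyadic level sets of |x| costs a factor 2, whence C = 2. If alpha = 0, the
   same bound with n = d = 1 shows |x| <= m a.e. *)

Require Import Defs.
From mathcomp Require Import all_boot all_order all_algebra.
From mathcomp Require Import all_classical all_reals all_analysis.
From mathcomp Require Import measurable_realfun ess_sup_inf ring lra.
Set Implicit Arguments.
Unset Strict Implicit.
Unset Printing Implicit Defensive.
Import Order.TTheory GRing.Theory Num.Theory.
Import numFieldNormedType.Exports.
Local Open Scope classical_set_scope.
Local Open Scope ring_scope.

(** * Distribution functions and rearrangements *)

Lemma measurable_unit_itv (R : realType) : measurable (unit_itv R).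
Proof. exact: measurable_itv. Qed.

Lemma unit_itvE (R : realType) (u : R) : unit_itv R u = (0 <= u <= 1) :> Prop.
Proof. by rewrite /unit_itv/= in_itv. Qed.

Lemma measurable_unit_square (R : realType) : measurable (unit_square R).
Proof. by apply: measurableX; exact: measurable_unit_itv. Qed.

Lemma lebesgue_unit_itv (R : realType) : lebesgue_measure (unit_itv R) = 1%E.
Proof. by rewrite /unit_itv lebesgue_measure_itv/= lte_fin ltr01 sube0. Qed.

Lemma lebesgue_rectangle (R : realType) (A B : set R) :
  measurable A -> measurable B ->
  ((lebesgue_measure \x lebesgue_measure)%E (A `*` B) =
    lebesgue_measure A * lebesgue_measure B)%E.
Proof. by move=> mA mB; rewrite product_measure1E. Qed.

Lemma lebesgue_unit_square (R : realType) :
  (lebesgue_measure \x lebesgue_measure)%E (unit_square R) = 1%E.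
Proof.
rewrite lebesgue_rectangle; [|exact: measurable_unit_itv..].
by rewrite -[RHS]mule1; congr (_ * _)%E; exact: lebesgue_unit_itv.
Qed.

(** These properties, with right continuity in the form it takes for a non-increasing function, are
    what rearrangement relies on. Isolating them lets [rearr] be studied once for both [distr1] and
    [distr2]. *)
Record distr_like (R : realType) (n : R -> \bar R) : Prop := DistrLike {
  distr_ge0 : forall tau, (0 <= n tau)%E ;
  distr_le1 : forall tau, (n tau <= 1)%E ;
  distr_anti : forall a b, a <= b -> (n b <= n a)%E ;
  distr_rc : forall t tau, (t < n tau)%E -> exists2 s, tau < s & (t < n s)%E ;
  distr_van : forall t, (0 < t)%E -> exists2 s, 0 < s & (n s < t)%E }.

Section distr_fun_props.
Context {d} {T : measurableType d} {R : realType}.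
Variables (m : {measure set T -> \bar R}) (D : set T).
Hypothesis mD : measurable D.
Hypothesis mD1 : m D = 1%E.

Lemma measurable_distr_set (z : T -> R) tau : measurable_fun D z ->
  measurable (D `&` [set w | tau < `|z w|]).
Proof.
move=> mz; have := measurableT_comp (@normr_measurable R setT) mz.
move=> /(_ mD) /(_ `]tau, +oo[%classic (measurable_itv _)).
by congr measurable; apply/seteqP; split => w /=; rewrite in_itv/= andbT.
Qed.

Lemma distr_fun_le (z z' : T -> R) tau tau' : measurable_fun D z ->
  measurable_fun D z' -> (forall w, D w -> tau < `|z w| -> tau' < `|z' w|) ->
  (distr_fun m D z tau <= distr_fun m D z' tau')%E.
Proof.
move=> mz mz' H; apply: le_measure; rewrite ?inE; try exact: measurable_distr_set.
by move=> w [/= Dw /(H _ Dw)].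
Qed.

Lemma distr_fun_like (z : T -> R) :
  measurable_fun D z -> distr_like (distr_fun m D z).
Proof.
move=> mz; split.
- by move=> tau; exact: measure_ge0.
- move=> tau; rewrite -mD1 le_measure ?inE//.
  exact: measurable_distr_set.
- by move=> a b ab; apply: distr_fun_le => // w _; exact: le_lt_trans.
- move=> t tau tlt.
  (* Right continuity: the superlevel set at [tau] is the increasing union of these sets, so
     continuity of the measure from below applies. *)
  pose F k := D `&` [set w | tau + k.+1%:R^-1 < `|z w|].
  have mF k : measurable (F k) by exact: measurable_distr_set.
  have FE : \bigcup_k F k = D `&` [set w | tau < `|z w|].
    apply/seteqP; split => [w [k _ [Dw /= h]]|w [Dw /= h]].
      by split => //=; apply: lt_trans h; rewrite ltrDl.
    have [k hk] := @ltr_add_invr R _ _ h.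
    by exists k => //; split.
  have ndF : nondecreasing_seq F.
    move=> i j ij; rewrite subsetEset => w [Dw /= h]; split => //=.
    apply: le_lt_trans h; rewrite lerD2l lef_pV2 ?posrE ?ler_nat//.
  have := @nondecreasing_cvg_mu _ _ _ m F mF _ ndF.
  rewrite FE => /(_ (measurable_distr_set tau mz)) cF.
  have : \forall k \near \oo, (t < m (F k))%E.
    apply: (cF [set y | (t < y)%E]); apply: open_nbhs_nbhs.
    by split => //; exact: open_ereal_gt_ereal.
  move=> [N _ /(_ N (leqnn N)) /= h].
  by exists (tau + N.+1%:R^-1) => //; rewrite ltrDl.
- move=> t t0.
  (* Decay at infinity: these sets decrease to the empty set because z is real-valued, and
     continuity from above applies because D has measure 1. *)
  pose F k := D `&` [set w | k.+1%:R < `|z w|].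
  have mF k : measurable (F k) by exact: measurable_distr_set.
  have FE : \bigcap_k F k = set0.
    apply/seteqP; split => [w h|//].
    have [_ /=] := h (Num.truncn `|z w|) I.
    by rewrite ltNge ltW// truncnS_gt.
  have niF : nonincreasing_seq F.
    move=> i j ij; rewrite subsetEset => w [Dw /= h]; split => //=.
    by apply: le_lt_trans h; rewrite ler_nat.
  have F0 : (m (F 0%N) < +oo)%E.
    apply: (@le_lt_trans _ _ (m D)); last by rewrite mD1 ltry.
    by rewrite le_measure ?inE// => w [].
  have := @nonincreasing_cvg_mu _ _ _ m F F0 mF _ niF.
  rewrite FE => /(_ measurable0); rewrite measure0 => cF.
  have : \forall k \near \oo, (m (F k) < t)%E.
    apply: (cF [set y | (y < t)%E]); apply: open_nbhs_nbhs.
    by split => //; exact: open_ereal_lt_ereal.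
  by move=> [N _ /(_ N (leqnn N)) /= h]; exists N.+1%:R.
Qed.

End distr_fun_props.

Lemma distr1_like (R : realType) (x : R -> R) :
  measurable_fun (unit_itv R) x -> distr_like (distr1 x).
Proof.
apply: (@distr_fun_like _ _ _ (@lebesgue_measure R)).
  exact: measurable_unit_itv.
exact: lebesgue_unit_itv.
Qed.

Lemma distr2_like (R : realType) (z : R * R -> R) :
  measurable_fun (unit_square R) z -> distr_like (distr2 z).
Proof.
apply: (@distr_fun_like _ _ _ (lebesgue_measure \x lebesgue_measure)%E).
  exact: measurable_unit_square.
exact: lebesgue_unit_square.
Qed.

Section rearrangement.
Context {R : realType}.
Implicit Types (n : R -> \bar R) (t tau : R).

Let rset n t := [set tau | 0 < tau /\ (n tau < t%:E)%E].

Let rset_lb n t : lbound (rset n t) 0.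
Proof. by move=> s [/ltW]. Qed.

Let rset_has_lb n t : has_lbound (rset n t).
Proof. by exists 0. Qed.

Let rset_n0 n t : distr_like n -> 0 < t -> rset n t !=set0.
Proof.
move=> dn t0.
by have [|s s0 h] := distr_van dn (t := t%:E); [rewrite lte_fin|exists s].
Qed.

Lemma rearr_ge0 n t : 0 <= rearr n t.
Proof.
rewrite /rearr -[X in inf X]/(rset n t).
by have [->|/set0P rn] := eqVneq (rset n t) set0; [rewrite inf0|exact: lb_le_inf].
Qed.

(** The set under the infimum is empty, and [inf set0] is 0 by convention. This fixes the value at
    the endpoint 0 of I. *)
Lemma rearr_le0 n t : distr_like n -> t <= 0 -> rearr n t = 0.
Proof.
move=> dn t0; rewrite /rearr -[X in inf X]/(rset n t).
suff -> : rset n t = set0 by rewrite inf0.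
apply/seteqP; split => // s [_]; rewrite ltNge => /negP; apply.
by apply: le_trans (distr_ge0 dn s); rewrite lee_fin.
Qed.

Lemma rearr_le n t tau : 0 < tau -> (n tau < t%:E)%E -> rearr n t <= tau.
Proof. by move=> tau0 nt; exact: (ge_inf (rset_has_lb n t)). Qed.

(** Right continuity supplies a level s above tau at which n still exceeds t. Every admissible level
    is then at least s, which makes the conclusion strict. *)
Lemma rearr_gt n t tau : distr_like n -> 0 < tau -> 0 < t ->
  (t%:E < n tau)%E -> tau < rearr n t.
Proof.
move=> dn tau0 t0 /(distr_rc dn) [s taus ts].
apply: lt_le_trans taus _; apply: lb_le_inf; first exact: rset_n0.
move=> u [u0 nu]; rewrite leNgt; apply/negP => us.
have := distr_anti dn (ltW us); rewrite leNgt => /negP; apply.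
exact: lt_trans nu ts.
Qed.

Lemma rearr_anti n s t : distr_like n -> 0 < s -> s <= t -> rearr n t <= rearr n s.
Proof.
move=> dn s0 st; apply: lb_le_inf; first exact: rset_n0.
move=> u [u0 nu]; apply: (ge_inf (rset_has_lb _ _)); split => //.
by apply: lt_le_trans nu _; rewrite lee_fin.
Qed.

Lemma rearr_mono n n' t : distr_like n -> distr_like n' ->
  (forall tau, 0 < tau -> (n tau <= n' tau)%E) -> rearr n t <= rearr n' t.
Proof.
move=> dn dn' nn'; have [t0|t0] := leP t 0; first by rewrite !rearr_le0.
apply: lb_le_inf; first exact: rset_n0.
move=> u [u0 nu]; apply: (ge_inf (rset_has_lb _ _)); split => //.
exact: le_lt_trans (nn' _ u0) nu.
Qed.

Lemma measurable_rearr n : distr_like n -> measurable_fun (unit_itv R) (rearr n).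
Proof.
move=> dn mD; apply: (measurability _ (RGenOInfty.measurableE R)) => //.
move=> /= _ [_ [a ->]] <-; have [a0|a0] := ltP a 0.
  rewrite (_ : _ `&` _ = unit_itv R)//.
  apply/seteqP; split => [x []//|x Ix]; split => //=.
  by rewrite in_itv/= andbT (lt_le_trans a0)// rearr_ge0.
(* The superlevel set is an interval by monotonicity on t > 0. The point 0, where [rearr] has the
   default value 0, is not in it since a >= 0. *)
apply: is_interval_measurable => x y [Ix] /=.
rewrite !in_itv/= !andbT => ax [Iy ay] z /andP[xz zy].
have x0 : 0 < x.
  by rewrite ltNge; apply/negP => x0; move: ax; rewrite rearr_le0// ltNge a0.
split.
  move: Ix Iy; rewrite /unit_itv/= !in_itv/= => /andP[? _] /andP[_ ?]; lra.
rewrite in_itv/= andbT; apply: lt_le_trans ay _; apply: rearr_anti => //.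
exact: lt_le_trans x0 xz.
Qed.

(** With b = n tau, the set where the rearrangement exceeds tau lies between the open and the closed
    interval from 0 to b, and both have measure b. *)
Lemma distr1_rearr n tau : distr_like n -> 0 < tau -> distr1 (rearr n) tau = n tau.
Proof.
move=> dn tau0.
have n01 : n tau \is a fin_num.
  by rewrite fin_numElt (lt_le_trans ltNy0 (distr_ge0 dn _))
    (le_lt_trans (distr_le1 dn _))// ltry.
pose b := fine (n tau).
have bE : n tau = b%:E by rewrite /b fineK.
have b0 : 0 <= b by rewrite -lee_fin -bE; exact: distr_ge0.
have b1 : b <= 1 by rewrite -lee_fin -bE; exact: distr_le1.
have mS : measurable (unit_itv R `&` [set w | tau < `|rearr n w|]).
  by apply: measurable_distr_set; [exact: measurable_unit_itv|exact: measurable_rearr].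
rewrite /distr1 /distr_fun; apply/eqP; rewrite eq_le; apply/andP; split.
- apply: (@le_trans _ _ (lebesgue_measure `[0, b]%classic)).
    apply: le_measure; rewrite ?inE//.
    move=> w []; rewrite unit_itvE => /andP[w0 w1] /=.
    rewrite ger0_norm ?rearr_ge0// => tw; rewrite in_itv/= w0/= leNgt.
    apply/negP => bw.
    by move: tw; rewrite ltNge rearr_le// bE lte_fin.
  by rewrite lebesgue_measure_itv/= bE lte_fin; case: ltP => //; rewrite ?sube0.
- apply: (@le_trans _ _ (lebesgue_measure `]0, b[%classic)).
    rewrite lebesgue_measure_itv/= bE lte_fin; case: ltP => //; rewrite ?sube0//.
  apply: le_measure; rewrite ?inE//.
  move=> w /=; rewrite in_itv/= => /andP[w0 wb]; split => /=.
    by rewrite unit_itvE ltW//= (le_trans (ltW wb)).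
  by rewrite ger0_norm ?rearr_ge0// rearr_gt// bE lte_fin.
Qed.

End rearrangement.

Section symmetric_space_domination.
Context {R : realType} (E : symmetric_space R).
Implicit Types x y : R -> R.

(** Symmetry replaces both functions by their rearrangements, for which domination of the
    distributions becomes a pointwise inequality, and the ideal property applies. This is the main
    tool for comparing norms in E. *)
Lemma sp_dominated x y : measurable_fun (unit_itv R) x -> mem_sp E y ->
  (forall tau, 0 < tau -> (distr1 x tau <= distr1 y tau)%E) ->
  mem_sp E x /\ norm_sp E x <= norm_sp E y.
Proof.
move=> mx Ey xy; have my := sp_measurable Ey.
have dx := distr1_like mx; have dy := distr1_like my.
have [Ey' ny'] : mem_sp E (rearr (distr1 y)) /\
    norm_sp E (rearr (distr1 y)) = norm_sp E y.
  apply: sp_symmetric => //; first exact: measurable_rearr.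
  by move=> tau tau0; rewrite distr1_rearr.
have [Ex' nx'] : mem_sp E (rearr (distr1 x)) /\
    norm_sp E (rearr (distr1 x)) <= norm_sp E (rearr (distr1 y)).
  apply: sp_ideal => //; first exact: measurable_rearr.
  apply: aeW => u _; rewrite !ger0_norm ?rearr_ge0//; exact: rearr_mono.
have [Ex nx] : mem_sp E x /\ norm_sp E x = norm_sp E (rearr (distr1 x)).
  by apply: sp_symmetric => // tau tau0; rewrite distr1_rearr.
by split => //; rewrite nx (le_trans nx')// ny'.
Qed.

End symmetric_space_domination.

(** * Dilations and tensor products *)

(** The pushforward of Lebesgue measure under u -> u / t, multiplied by 1 / t, agrees with Lebesgue
    measure on half-open intervals, hence everywhere by uniqueness. *)
Lemma lebesgue_measure_dilation (R : realType) (t : R) (A : set R) : 0 < t ->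
  measurable A ->
  (lebesgue_measure ((fun u : R => (u / t)%R) @^-1` A) =
    t%:E * lebesgue_measure A)%E.
Proof.
move=> t0 mA.
have ti0 : 0 <= t^-1 by rewrite invr_ge0 ltW.
have mt : measurable_fun setT (fun u : R => u / t).
  by apply: measurable_funM.
have key : lebesgue_measure A =
    pushforward (mscale (NngNum ti0) lebesgue_measure)
      (fun u : R => u / t : measurableTypeR R) A.
  apply: lebesgue_measure_unique => //= _ [[a b]] _ <-.
  rewrite /pushforward/mscale/=.
  have -> : (fun u => u / t) @^-1` `]a, b] = `]a * t, b * t]%classic.
    by apply/seteqP; split => u /=; rewrite !in_itv/= ltr_pdivlMr// ler_pdivrMr.
  rewrite !lebesgue_measure_itv/= !lte_fin ltr_pM2r//.
  case: ltP => _; last by rewrite mule0.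
  by rewrite -EFinB -EFinM; congr EFin; field; rewrite gt_eqF.
rewrite key /pushforward/mscale/= muleA -EFinM divff ?gt_eqF// mul1e//.
Qed.

Section distribution_operations.
Context {R : realType}.
Implicit Types x y : R -> R.

Lemma distr1_scale (a : R) y tau : 0 < a ->
  distr1 (fun u => a * y u) tau = distr1 y (tau / a).
Proof.
move=> a0; rewrite /distr1 /distr_fun; congr (lebesgue_measure (_ `&` _)).
by apply/seteqP; split => w /=; rewrite normrM (gtr0_norm a0) ltr_pdivrMr// mulrC.
Qed.

Lemma distr2_scaler (a : R) x y tau : 0 < a ->
  distr2 (tensor x (fun u => a * y u)) tau = distr2 (tensor x y) (tau / a).
Proof.
move=> a0; rewrite /distr2 /distr_fun; congr (_ (_ `&` _)).
apply/seteqP; split => w /=;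
  by rewrite /tensor/= mulrCA (normrM a) (gtr0_norm a0) ltr_pdivrMr// mulrC.
Qed.

Lemma measurable_scale (D : set R) (a : R) y :
  measurable_fun D y -> measurable_fun D (fun u => a * y u).
Proof. by move=> my; apply: measurable_funM. Qed.

Lemma measurable_dilation (t : R) y : 0 < t ->
  measurable_fun (unit_itv R) y -> measurable_fun (unit_itv R) (dilation t y).
Proof.
move=> t0 my.
have mt : measurable_fun setT (fun u : R => u / t) by apply: measurable_funM.
have mz : measurable_fun setT (fun u => y u * \1_(unit_itv R) u).
  have := (measurable_restrict y (@measurable_unit_itv R) measurableT).1.
  rewrite setTI => /(_ my); congr measurable_fun; apply/funext => u.
  rewrite patchE indicE; case: (u \in unit_itv R); rewrite ?mulr1 ?mulr0//.
exact: measurable_funTS (measurableT_comp mz mt).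
Qed.

(** Since t <= 1, multiplying a superlevel set of y by t leaves it inside I, so that restricting to
    I cuts nothing off. *)
Lemma distr1_dilation (t : R) y tau : 0 < t -> t <= 1 -> 0 < tau ->
  measurable_fun (unit_itv R) y ->
  (distr1 (dilation t y) tau = t%:E * distr1 y tau)%E.
Proof.
move=> t0 t1 tau0 my; rewrite /distr1 /distr_fun -lebesgue_measure_dilation//.
  congr lebesgue_measure; apply/seteqP; split => u.
    move=> [Iu] /=; rewrite /dilation indicE.
    have [|_] := boolP (u / t \in unit_itv R); last by rewrite mulr0 normr0 ltNge ltW.
    by rewrite inE mulr1.
  move=> [Iut] /=; rewrite /dilation indicE mem_set// mulr1 => ->; split => //.
  move: Iut; rewrite !unit_itvE => /andP[h1 h2]; apply/andP; split.
    by rewrite -(pmulr_lge0 _ (_ : 0 < t^-1)) ?invr_gt0// mulrC.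
  by move: h2; rewrite ler_pdivrMr// mul1r => /le_trans; apply.
by apply: measurable_distr_set => //; exact: measurable_unit_itv.
Qed.

Lemma dilationM (s t : R) y : 0 < s -> 0 < t -> t <= 1 -> s <= 1 ->
  dilation t (dilation s y) = dilation (t * s) y.
Proof.
move=> s0 t0 t1 s1; apply/funext => u; rewrite /dilation.
have -> : u / t / s = u / (t * s) by field; rewrite ?gt_eqF.
rewrite -mulrA; congr (_ * _); rewrite !indicE.
have [|ts] := boolP (u / (t * s) \in unit_itv R); last by rewrite mul0r.
rewrite inE unit_itvE => /andP[h1 h2].
(* As s <= 1, the cut-off at u / t is implied by the one at u / (t s). *)
have uE : u / t = u / (t * s) * s by field; rewrite ?gt_eqF.
rewrite mem_set ?mulr1// unit_itvE uE mulr_ge0 ?(ltW s0)//=.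
by rewrite mulr_ile1// ltW.
Qed.

Lemma measurable_tensor x y : measurable_fun (unit_itv R) x ->
  measurable_fun (unit_itv R) y -> measurable_fun (unit_square R) (tensor x y).
Proof.
move=> mx my; apply: measurable_funM.
  apply: (measurable_comp (@measurable_unit_itv R) _ mx); last exact: measurable_funTS.
  by move=> _ [w [? _] <-].
apply: (measurable_comp (@measurable_unit_itv R) _ my); last exact: measurable_funTS.
by move=> _ [w [_ ?] <-].
Qed.

(** The rectangles with sides A_j and the set where |y| exceeds tau / a_j are pairwise disjoint and
    lie in the superlevel set of the tensor product. *)
Lemma distr2_tensor_ge x y (A : nat -> set R) (a : nat -> R) (d : nat) tau :
  measurable_fun (unit_itv R) x -> measurable_fun (unit_itv R) y ->
  (forall j, measurable (A j)) -> trivIset setT A ->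
  (forall j, A j `<=` unit_itv R) -> (forall j, 0 < a j) ->
  (forall j s, A j s -> a j <= `|x s|) ->
  (\sum_(j < d) lebesgue_measure (A j) * distr1 y (tau / a j)
    <= distr2 (tensor x y) tau)%E.
Proof.
move=> mx my mA tA AI a0 ax.
pose B j := unit_itv R `&` [set w | tau / a j < `|y w|].
have mB j : measurable (B j).
  by apply: measurable_distr_set => //; exact: measurable_unit_itv.
pose F j := A j `*` B j.
have mF j : measurable (F j) by apply: measurableX.
have tF : trivIset setT F.
  apply/trivIsetP => i j _ _ ij; apply/seteqP; split => // w [[wi _] [wj _]].
  move/trivIsetP : tA => /(_ i j I I ij) Aij.
  by have : (A i `&` A j) w.1 by []; rewrite Aij.
have := @measure_bigsetU _ _ _ (lebesgue_measure \x lebesgue_measure)%E F mF tF d.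
rewrite (eq_bigr (fun j : 'I_d => (lebesgue_measure (A j) * distr1 y (tau / a j))%E)).
  move=> <-; apply: le_measure; rewrite ?inE.
  - by apply: bigsetU_measurable => j _; exact: mF.
  - apply: measurable_distr_set; first exact: measurable_unit_square.
    exact: measurable_tensor.
  rewrite -bigcup_mkord => w [j _ [Aw [Iw /= Bw]]]; split; first by split => //; exact: AI Aw.
  rewrite /tensor/= normrM.
  move: Bw; rewrite ltr_pdivrMr// mulrC => /lt_le_trans; apply.
  by apply: ler_wpM2r => //; exact: ax Aw.
by move=> j _; exact: lebesgue_rectangle.
Qed.

(** The product measure integrates the measures of sections. The section at s is the superlevel set
    of the second factor at height tau / |x s|, and it is empty where x s = 0. *)
Lemma distr2_tensor_mono x y y' tau : 0 < tau ->
  measurable_fun (unit_itv R) x -> measurable_fun (unit_itv R) y ->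
  measurable_fun (unit_itv R) y' ->
  (forall tau, 0 < tau -> (distr1 y tau <= distr1 y' tau)%E) ->
  (distr2 (tensor x y) tau <= distr2 (tensor x y') tau)%E.
Proof.
move=> tau0 mx my my' yy'.
pose S z := unit_square R `&` [set w | tau < `|tensor x z w|].
have mS z : measurable_fun (unit_itv R) z -> measurable (S z).
  move=> mz; apply: measurable_distr_set; first exact: measurable_unit_square.
  exact: measurable_tensor.
have Ssec z s : x s != 0 -> unit_itv R s ->
    lebesgue_measure (xsection (S z) s) = distr1 z (tau / `|x s|).
  move=> xs Is; rewrite /distr1 /distr_fun; congr lebesgue_measure.
  apply/seteqP; split => t; rewrite /xsection/= inE /S /tensor/= normrM.
    by move=> [[_ It]] h; split => //=; rewrite ltr_pdivrMr ?normr_gt0// mulrC.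
  by move=> [It]; rewrite ltr_pdivrMr ?normr_gt0// mulrC.
have Ssec0 z s : x s = 0 \/ ~ unit_itv R s -> xsection (S z) s = set0.
  move=> h; apply/seteqP; split => // t; rewrite /xsection/= inE => -[[Is _]] /=.
  case: h => // xs0; rewrite /tensor/= xs0 mul0r normr0 ltNge ltW//.
apply: ge0_le_integral => //.
- by apply: measurable_fun_xsection; exact: mS my.
- by apply: measurable_fun_xsection; exact: mS my'.
move=> s _ /=; rewrite -/(S y) -/(S y').
have [xs0|xs0] := eqVneq (x s) 0; first by rewrite !Ssec0//; left.
have [Is|Is] := pselect (unit_itv R s); last by rewrite !Ssec0//; right.
by rewrite !Ssec// yy'// divr_gt0// normr_gt0.
Qed.

End distribution_operations.

(** * Indices of submultiplicative functions *)

Section submultiplicative.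
Context {R : realType}.
Variable N : R -> R.
Hypothesis N_gt0 : forall t, 0 < t <= 1 -> 0 < N t.
Hypothesis N_le1 : forall t, 0 < t <= 1 -> N t <= 1.
Hypothesis N_mul : forall s t, 0 < s <= 1 -> 0 < t <= 1 -> N (s * t) <= N s * N t.
(** This lower bound keeps ln (N t) / ln t bounded near 0, so that its supremum there is a real
    number. *)
Hypothesis N_half : forall n, 2^-1 ^+ n <= N (2^-1 ^+ n).

Let g t := ln (N t) / ln t.

Let N_anti s t : 0 < s -> s <= t -> t <= 1 -> N s <= N t.
Proof.
move=> s0 st t1; have t0 : 0 < t by apply: lt_le_trans st.
have -> : s = t * (s / t) by field; rewrite gt_eqF.
have st01 : 0 < s / t <= 1 by rewrite divr_gt0//= ler_pdivrMr// mul1r.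
apply: le_trans (N_mul _ st01) _; first by rewrite t0.
by rewrite ler_piMr// ?N_le1// ltW// N_gt0// t0.
Qed.

Let N_exp s n : 0 < s <= 1 -> N (s ^+ n.+1) <= N s ^+ n.+1.
Proof.
move=> s01; have /andP[s0 s1] := s01; elim: n => [|n IH]; first by rewrite !expr1.
have sn01 : 0 < s ^+ n.+1 <= 1 by rewrite exprn_gt0//= exprn_ile1// ltW.
rewrite exprS [leRHS]exprS; apply: le_trans (N_mul s01 sn01) _.
by rewrite ler_wpM2l// ltW// N_gt0.
Qed.

Let lnN_le0 t : 0 < t <= 1 -> ln (N t) <= 0.
Proof. by move=> t01; rewrite ln_le0// N_le1. Qed.

Let g_ge0 t : 0 < t < 1 -> 0 <= g t.
Proof.
move=> /andP[t0 t1]; rewrite /g -mulrNN -invrN mulr_ge0//.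
  by rewrite oppr_ge0 lnN_le0// t0 ltW.
by rewrite invr_ge0 oppr_ge0 ln_le0// ltW.
Qed.

(** Fekete's argument with an explicit error. If n is the integer part of ln t / ln s, then t <= s^n
    gives N t <= (N s)^n, and rounding down costs at most ln (N s) / ln t. *)
Let g_lower s t : 0 < s < 1 -> 0 < t < 1 -> g s - ln (N s) / ln t <= g t.
Proof.
move=> /andP[s0 s1] /andP[t0 t1].
have s01 : 0 < s <= 1 by rewrite s0 ltW.
have t01 : 0 < t <= 1 by rewrite t0 ltW.
pose a := - ln (N s); pose b := - ln s; pose L := - ln t.
have b0 : 0 < b by rewrite oppr_gt0 ln_lt0// s0.
have L0 : 0 < L by rewrite oppr_gt0 ln_lt0// t0.
have a0 : 0 <= a by rewrite oppr_ge0 lnN_le0// s0 ltW.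
have -> : ln (N s) / ln t = a / L by rewrite /a /L invrN mulrNN.
have gsE : g s = a / b by rewrite /g /a /b invrN mulrNN.
have := @truncn_le _ (L / b); have := @truncnS_gt _ (L / b).
rewrite (divr_ge0 (ltW L0) (ltW b0)); case: (Num.truncn (L / b)) => [|n].
  (* Integer part 0 means s < t, and then the left-hand side is at most 0. *)
  move=> Lb _; apply: le_trans (g_ge0 _); last by rewrite t0.
  rewrite subr_le0 gsE ler_wpM2l// lef_pV2 ?posrE//.
  by move: Lb; rewrite ltr_pdivrMr// mul1r => /ltW.
move=> Lb1 Lb2.
have ts : t <= s ^+ n.+1.
  rewrite -ler_ln ?posrE ?exprn_gt0// lnXn// -[leLHS]opprK -[leRHS]opprK lerN2.
  by rewrite -/L -mulNrn -/b -mulr_natl -ler_pdivlMr.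
have NtL : n.+1%:R * a <= - ln (N t).
  rewrite /a mulrN lerN2 mulr_natl -lnXn ?N_gt0//.
  rewrite ler_ln ?posrE ?exprn_gt0 ?N_gt0//.
  apply: le_trans (N_exp n s01); apply: N_anti => //.
  by apply: exprn_ile1; rewrite ltW.
have -> : g t = - ln (N t) / L by rewrite /g /L invrN mulrNN.
apply: (@le_trans _ _ (n.+1%:R * a / L)); last by rewrite ler_pM2r ?invr_gt0.
have -> : g s - a / L = (L / b - 1) * a / L.
  by rewrite gsE; field; rewrite !gt_eqF.
rewrite ler_pM2r ?invr_gt0// ler_wpM2r//.
by rewrite lerBlDr natr1 ltW.
Qed.

(** Comparison with a power of 1/2 between t / 2 and t gives N t >= t / 2, which is at least t^2 for
    t <= 1/2. *)
Let g_ubound t : 0 < t <= 2^-1 -> g t <= 2.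
Proof.
move=> /andP[t0 t1].
have t12 : t < 1 by lra.
have L0 : 0 < - ln t by rewrite oppr_gt0 ln_lt0// t0.
have l2 : 0 < ln (2 : R) by rewrite ln_gt0// ltr1n.
pose n := Num.truncn (- ln t / ln 2).
have n1 : n%:R <= - ln t / ln 2 by rewrite truncn_le// divr_ge0// ltW.
have n2 : - ln t / ln 2 < n.+1%:R by rewrite truncnS_gt.
have pow_gt0 k : 0 < (2^-1 : R) ^+ k by rewrite exprn_gt0// invr_gt0.
have lnp k : ln ((2^-1 : R) ^+ k) = - (k%:R * ln 2).
  by rewrite lnXn ?invr_gt0// lnV ?posrE// mulNrn mulr_natl.
have pt : 2^-1 ^+ n.+1 <= t.
  rewrite -ler_ln ?posrE// lnp lerNl -ler_pdivrMr//; exact: ltW.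
have tp : t / 2 <= 2^-1 ^+ n.+1.
  rewrite exprS mulrC ler_pM2l ?invr_gt0//.
  rewrite -ler_ln ?posrE// lnp lerNr -ler_pdivlMr//.
have Nt : t / 2 <= N t.
  apply: le_trans tp _; apply: le_trans (N_half _) _.
  exact: N_anti (pow_gt0 _) pt (ltW t12).
rewrite /g -mulrNN -invrN ler_pdivrMr// lerNl.
rewrite (@le_trans _ _ (ln (t / 2)))// ?ler_ln ?posrE ?divr_gt0 ?N_gt0 ?t0 ?(ltW t12)//.
rewrite ln_div ?posrE//.
have -> : - (2 * - ln t) = ln t - - ln t by ring.
by rewrite lerD2l lerN2 lerNr -lnV ?posrE// ler_ln ?posrE// invr_gt0.
Qed.

(** The limit exists and equals the supremum of g on (0, 1/2], and no g s with s < 1 exceeds it. As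
    ln s < 0, the inequality g s <= alpha reads s^alpha <= N s. *)
Lemma submultiplicative_index :
  let alpha := lim (ln (N t) / ln t @[t --> 0^'+]) in
  0 <= alpha /\ forall s, 0 < s <= 1 -> s `^ alpha <= N s.
Proof.
pose S := [set g t | t in [set t | 0 < t <= 2^-1]].
have h01 : 0 < (2^-1 : R) <= 2^-1 by rewrite invr_gt0 lexx andbT.
have half1 (t : R) : 0 < t <= 2^-1 -> 0 < t < 1 by move=> /andP[-> h]/=; lra.
have Sn0 : S !=set0 by exists (g 2^-1), 2^-1.
have Sub : has_ubound S by exists 2 => _ [t tt <-]; exact: g_ubound.
have gS t : 0 < t <= 2^-1 -> g t <= sup S.
  by move=> tt; apply: ub_le_sup => //; exists t.
have S0 : 0 <= sup S by apply: le_trans (gS _ h01); apply: g_ge0; exact: half1.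
have nearlow s e : 0 < s < 1 -> 0 < e -> \forall t \near 0^'+, g s - e <= g t.
  move=> ss e0; have /andP[s0 s1] := ss.
  have a0 : 0 <= - ln (N s) by rewrite oppr_ge0 lnN_le0// s0 ltW.
  (* For t below this threshold the error ln (N s) / ln t of [g_lower] is at most e. *)
  pose d := expR (ln (N s) / e).
  have d0 : 0 < d by exact: expR_gt0.
  near=> t.
  have t0 : 0 < t by [].
  have td : t < d by near: t; exact: nbhs_right_lt.
  have t1 : t < 1 by near: t; exact: nbhs_right_lt.
  apply: le_trans (g_lower ss _); last by rewrite t0.
  rewrite lerD2l lerN2 -mulrNN -invrN ler_pdivrMr ?oppr_gt0 ?ln_lt0 ?t0//.
  rewrite mulrC -ler_pdivrMr// mulNr lerNr opprK -[leRHS]expRK ler_ln ?posrE//.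
  exact: ltW.
have gcvg : g t @[t --> 0^'+] --> sup S.
  apply/cvgrPdist_le => e e0.
  have [_ [s ss <-] hs] : exists2 y, S y & sup S - e / 2 < y.
    by apply: sup_adherent => //; rewrite divr_gt0.
  near=> t.
  have t0 : 0 < t by [].
  have th : t <= 2^-1 by near: t; apply: nbhs_right_le; rewrite invr_gt0.
  have low : g s - e / 2 <= g t.
    by near: t; apply: nearlow; [exact: half1|rewrite divr_gt0].
  rewrite ger0_norm ?subr_ge0 ?gS ?t0//; lra.
have -> : lim (ln (N t) / ln t @[t --> 0^'+]) = sup S by exact: cvg_lim gcvg.
split=> // s /andP[s0]; rewrite le_eqVlt => /predU1P[->|s1].
  (* At s = 1 the claim is N 1 >= 1, which follows from N (1/2) <= N (1/2) * N 1. *)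
  rewrite powR1 -(@ler_pM2l _ (N 2^-1)); last by rewrite N_gt0//; lra.
  rewrite mulr1; have h1 : 0 < (2^-1 : R) <= 1 by lra.
  have := N_mul h1 (_ : 0 < 1 <= 1); rewrite mulr1; apply.
  by rewrite ltr01 lexx.
(* Here s may exceed 1/2, so g s is compared with g t for a small t. *)
have gsS : g s <= sup S.
  apply/ler_addgt0Pr => e e0; rewrite -lerBlDr.
  have [t [h1 h2]] : exists t, g s - e <= g t /\ 0 < t <= 2^-1.
    near (0 : R)^'+ => t; exists t; split.
      by near: t; apply: nearlow; rewrite ?s0.
    apply/andP; split => //; near: t; apply: nbhs_right_le; by rewrite invr_gt0.
  by apply: le_trans h1 _; exact: gS.
have Ns0 : 0 < N s by rewrite N_gt0// s0 ltW.
rewrite -ler_ln ?posrE ?powR_gt0// ln_powR.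
have ls : ln s < 0 by rewrite ln_lt0// s0.
by move: gsS; rewrite /g ler_ndivrMr.
Unshelve. all: by end_near. Qed.

End submultiplicative.

(** * The lower Boyd index *)

Section indicators.
Context {R : realType}.
Implicit Types (A B : set R) (y : R -> R).

Lemma distr1_indic A tau : 0 < tau -> A `<=` unit_itv R ->
  distr1 (\1_A) tau = if tau < 1 then lebesgue_measure A else 0%E.
Proof.
move=> tau0 AI; rewrite /distr1 /distr_fun; case: ifPn => tau1.
  congr lebesgue_measure; apply/seteqP; split => [u [_] /=|u Au].
    by rewrite indicE; case: (boolP (u \in A)); rewrite ?inE// normr0 ltNge ltW.
  by split; [exact: AI|rewrite /= indicE mem_set// normr1].
rewrite -leNgt in tau1; rewrite (_ : _ `&` _ = set0) ?measure0//.
apply/seteqP; split => // u [_] /=; apply/negP; rewrite -leNgt indicE.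
by apply: le_trans tau1; case: (u \in A); rewrite ?normr1 ?normr0.
Qed.

Lemma distr1_ae0 y : measurable_fun (unit_itv R) y ->
  (forall tau, 0 < tau -> distr1 y tau = 0%E) ->
  {ae lebesgue_measure, forall u, unit_itv R u -> y u = 0}.
Proof.
move=> my y0.
pose F k := unit_itv R `&` [set u | k.+1%:R^-1 < `|y u|].
have mF k : measurable (F k).
  by apply: measurable_distr_set => //; exact: measurable_unit_itv.
apply: (@negligibleS _ _ _ lebesgue_measure (\bigcup_k F k)).
  move=> u /= /not_implyP[Iu /eqP yu].
  have yu0 : 0 < `|y u| by rewrite normr_gt0.
  have [k] := ltr_add_invr yu0; rewrite add0r => hk.
  by exists k.
apply: negligible_bigcup => k.
exists (F k); split => //; first exact: mF.
by have h := y0 k.+1%:R^-1; apply: h; rewrite invr_gt0.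
Qed.

(** Dilations act on these functions by rescaling c, which makes them the test vectors for lower
    bounds on the dilation norm. *)
Definition init_indic (c : R) : R -> R := \1_(`[0, c]%classic).

Lemma dilation_init_indic (t c : R) : 0 < t -> c <= 1 ->
  dilation t (init_indic c) = init_indic (t * c).
Proof.
move=> t0 c1; apply/funext => u; rewrite /dilation /init_indic !indicE.
have -> : (u / t \in `[0, c]%classic) = (u \in `[0, t * c]%classic).
  rewrite !mem_setE !in_itv/= ler_pdivrMr// (mulrC c) pmulr_lge0 ?invr_gt0//.
have [|] := boolP (u \in _); last by rewrite mul0r.
rewrite mem_setE in_itv/= => /andP[u0 u1].
rewrite mem_set ?mulr1// unit_itvE divr_ge0 ?(ltW t0)//= ler_pdivrMr// mul1r.
by apply: le_trans u1 _; rewrite ler_piMr// ltW.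
Qed.

Lemma init_sub_unit (c : R) : c <= 1 -> `[0, c]%classic `<=` unit_itv R.
Proof.
by move=> c1 u /=; rewrite unit_itvE in_itv/= => /andP[-> /le_trans ->].
Qed.

Lemma measurable_indic_unit A : measurable A ->
  measurable_fun (unit_itv R) (\1_A : R -> R).
Proof. by move=> mA; apply: measurable_indic. Qed.

End indicators.

Section dilation_norm.
Context {R : realType} (E : symmetric_space R).
Implicit Types (t s c : R) (x y : R -> R).

Lemma sp_zero : mem_sp E (fun=> 0) /\ norm_sp E (fun=> 0) = 0.
Proof.
have [y Ey _] := sp_nonzero E.
have -> : (fun=> 0) = (fun u => 0 * y u) :> (R -> R).
  by apply/funext => u; rewrite mul0r.
by split; [exact: sp_scale|rewrite norm_spZ// normr0 mul0r].
Qed.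

(** A nonzero y exceeds some tau > 0 in modulus on a set of positive measure c, and then y / tau
    dominates the indicator of [0, c] in distribution. *)
Lemma init_indic_mem : exists c, [/\ 0 < c, c <= 1 & mem_sp E (init_indic c)].
Proof.
have [y Ey y0] := sp_nonzero E; have my := sp_measurable Ey.
have dy := distr1_like my.
have [tau tau0 dtau] : exists2 tau, 0 < tau & distr1 y tau <> 0%E.
  apply: contrapT => h; apply: y0; apply: distr1_ae0 => // tau tau0.
  by apply: contrapT => h'; apply: h; exists tau.
have dfin : distr1 y tau \is a fin_num.
  by rewrite fin_numElt (lt_le_trans ltNy0 (distr_ge0 dy _))
    (le_lt_trans (distr_le1 dy _))// ltry.
pose c := fine (distr1 y tau).
have cE : distr1 y tau = c%:E by rewrite fineK.
have c0 : 0 < c.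
  rewrite lt_neqAle -!lee_fin -cE (distr_ge0 dy) andbT eq_sym; apply/eqP => c0.
  by apply: dtau; rewrite cE c0.
have c1 : c <= 1 by rewrite -lee_fin -cE (distr_le1 dy).
exists c; split => //.
have /sp_scale -/(_ tau^-1) Ey' := Ey.
apply: (sp_dominated _ Ey' _).1; first by apply: measurable_indic_unit; exact: measurable_itv.
move=> s s0; rewrite distr1_scale ?invr_gt0// invrK distr1_indic//; last exact: init_sub_unit.
case: ifPn => s1; last exact: (distr_ge0 dy).
rewrite lebesgue_measure_itv/= lte_fin c0 sube0 -cE.
by apply: (distr_anti dy); rewrite ler_piMl// ltW.
Qed.

Lemma init_indic_norm_gt0 c : 0 < c -> c <= 1 -> mem_sp E (init_indic c) ->
  0 < norm_sp E (init_indic c).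
Proof.
move=> c0 c1 Ec; rewrite lt_neqAle norm_sp_ge0// andbT eq_sym; apply/eqP => h.
have [A [mA A0 hA]] := norm_sp_eq0 Ec h.
have : (lebesgue_measure (`[0%R, c]%classic : set R) <= lebesgue_measure A)%E.
  rewrite le_measure ?inE//.
  move=> u uc; apply: hA => /= /(_ (init_sub_unit c1 uc)).
  by rewrite /init_indic indicE mem_set// => /eqP; rewrite oner_eq0.
by rewrite lebesgue_measure_itv/= lte_fin c0 sube0 A0 lee_fin leNgt c0.
Qed.

Lemma dilation_mem t y : 0 < t <= 1 -> mem_sp E y ->
  mem_sp E (dilation t y) /\ norm_sp E (dilation t y) <= norm_sp E y.
Proof.
move=> /andP[t0 t1] Ey; have my := sp_measurable Ey.
apply: sp_dominated => //; first exact: measurable_dilation.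
move=> tau tau0; rewrite distr1_dilation//.
by rewrite -[leRHS]mul1e lee_wpmul2r// (distr_ge0 (distr1_like my)).
Qed.

Let dset t := [set norm_sp E (dilation t y) | y in
        [set y | mem_sp E y /\ norm_sp E y <= 1]].

Let dset0 t : dset t !=set0.
Proof.
have [E0 n0] := sp_zero.
by exists (norm_sp E (dilation t (fun=> 0))), (fun=> 0) => //=; rewrite n0.
Qed.

Let dset_ub t : 0 < t <= 1 -> ubound (dset t) 1.
Proof.
move=> t01 _ [y [Ey y1] <-]; apply: le_trans y1; exact: (dilation_mem t01 Ey).2.
Qed.

Lemma dilation_norm_le1 t : 0 < t <= 1 -> dilation_norm E t <= 1.
Proof. by move=> t01; apply: ge_sup; [exact: dset0|exact: dset_ub]. Qed.

Lemma dilation_norm_ge0 t : 0 < t <= 1 -> 0 <= dilation_norm E t.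
Proof.
move=> t01; have [E0 n0] := sp_zero.
apply: (@le_trans _ _ (norm_sp E (dilation t (fun=> 0)))).
  by apply: norm_sp_ge0; exact: (dilation_mem t01 E0).1.
apply: ub_le_sup; first by exists 1; exact: dset_ub.
by exists (fun=> 0) => //=; rewrite n0.
Qed.

Lemma dilation_norm_le t y : 0 < t <= 1 -> mem_sp E y ->
  norm_sp E (dilation t y) <= dilation_norm E t * norm_sp E y.
Proof.
move=> t01 Ey; have := norm_sp_ge0 Ey; rewrite le_eqVlt => /predU1P[n0|n0].
  (* A vector of norm 0 cannot be normalised, but its dilation has norm at most 0 as well. *)
  by rewrite -n0 mulr0 n0; exact: (dilation_mem t01 Ey).2.
have Ey' := sp_scale (norm_sp E y)^-1 Ey.
rewrite -ler_pdivrMr//; apply: ub_le_sup; first by exists 1; exact: dset_ub.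
exists (fun u => (norm_sp E y)^-1 * y u) => /=.
  by rewrite norm_spZ// gtr0_norm ?invr_gt0// mulVf// gt_eqF.
have -> : dilation t (fun u => (norm_sp E y)^-1 * y u) =
    (fun u => (norm_sp E y)^-1 * dilation t y u).
  by apply/funext => u; rewrite /dilation mulrA.
by rewrite norm_spZ ?gtr0_norm ?invr_gt0// 1?mulrC//; exact: (dilation_mem t01 Ey).1.
Qed.

Lemma dilation_norm_mul s t : 0 < s <= 1 -> 0 < t <= 1 ->
  dilation_norm E (s * t) <= dilation_norm E s * dilation_norm E t.
Proof.
move=> s01 t01; have /andP[s0 s1] := s01; have /andP[t0 t1] := t01.
apply: ge_sup; first exact: dset0.
move=> _ [y [Ey y1] <-]; rewrite -dilationM//.
apply: le_trans (dilation_norm_le s01 (dilation_mem t01 Ey).1) _.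
rewrite ler_wpM2l ?dilation_norm_ge0//.
apply: le_trans (dilation_norm_le t01 Ey) _.
by rewrite ler_piMr// dilation_norm_ge0.
Qed.

Lemma dilation_norm_gt0 t : 0 < t <= 1 -> 0 < dilation_norm E t.
Proof.
move=> t01; have /andP[t0 t1] := t01; have [c [c0 c1 Ec]] := init_indic_mem.
have nc := init_indic_norm_gt0 c0 c1 Ec.
rewrite -(pmulr_lgt0 _ nc); apply: lt_le_trans (dilation_norm_le t01 Ec).
have [Etc _] := dilation_mem t01 Ec; move: Etc.
rewrite dilation_init_indic// => Etc; apply: init_indic_norm_gt0 => //.
  exact: mulr_gt0.
by rewrite mulr_ile1// ltW.
Qed.

(* [0, c] is the union of two intervals equimeasurable with [0, c/2]. *)
Lemma init_indic_half c : 0 < c -> c <= 1 -> mem_sp E (init_indic (2^-1 * c)) ->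
  norm_sp E (init_indic c) <= 2 * norm_sp E (init_indic (2^-1 * c)).
Proof.
move=> c0 c1 Ec; pose J : set R := `[2^-1 * c, c]%classic.
have JI : J `<=` unit_itv R.
  by move=> u; rewrite unit_itvE /J/= in_itv/= => /andP[h1 h2]; lra.
have [EJ nJ] : mem_sp E (\1_J) /\ norm_sp E (\1_J) <= norm_sp E (init_indic (2^-1 * c)).
  apply: sp_dominated => //.
    by apply: measurable_indic_unit; exact: measurable_itv.
  move=> tau tau0; rewrite !distr1_indic//; last by apply: init_sub_unit; lra.
  case: ifPn => // _; rewrite /J !lebesgue_measure_itv/= !lte_fin.
  have -> : 2^-1 * c < c by lra.
  have -> : 0 < 2^-1 * c by lra.
  rewrite -!EFinB lee_fin; lra.
apply: (@le_trans _ _ (norm_sp E (init_indic (2^-1 * c) \+ \1_J))).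
  apply: (sp_ideal _ (sp_add Ec EJ) _).2.
    by apply: measurable_indic_unit; exact: measurable_itv.
  apply: aeW => u Iu /=; rewrite /init_indic !indicE.
  have [uc|] := boolP (u \in _); last by rewrite normr0 normr_ge0.
  rewrite normr1 ger0_norm ?addr_ge0//.
  move: uc; rewrite mem_setE in_itv/= => /andP[u0 uc].
  have [h|h] := leP u (2^-1 * c).
    rewrite [X in _ <= X + _](_ : _ = 1) ?lerDl//.
    by rewrite mem_set//= in_itv/= u0.
  rewrite [X in _ <= _ + X](_ : _ = 1) ?lerDr//.
  by rewrite mem_set// /J/= in_itv/= ltW.
apply: le_trans (norm_spD Ec EJ) _; lra.
Qed.

(** Tested on an indicator of some [0, c] in E: each halving of the interval divides the norm by at
    most 2. *)
Lemma dilation_norm_half n : 2^-1 ^+ n <= dilation_norm E (2^-1 ^+ n).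
Proof.
have [c [c0 c1 Ec]] := init_indic_mem.
have h0 k : 0 < (2^-1 : R) ^+ k by rewrite exprn_gt0// invr_gt0.
have h1 k : (2^-1 : R) ^+ k <= 1 by rewrite exprn_ile1//; lra.
have h01 k : 0 < (2^-1 : R) ^+ k <= 1 by rewrite h0 h1.
have Ek k : mem_sp E (init_indic (2^-1 ^+ k * c)).
  by rewrite -dilation_init_indic//; exact: (dilation_mem (h01 k) Ec).1.
have low k : 2^-1 ^+ k * norm_sp E (init_indic c) <=
    norm_sp E (init_indic (2^-1 ^+ k * c)).
  elim: k => [|k IH]; first by rewrite expr0 !mul1r.
  rewrite exprS -!mulrA; apply: (@le_trans _ _ (2^-1 * norm_sp E (init_indic (2^-1 ^+ k * c)))).
    by rewrite ler_pM2l// invr_gt0.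
  have := @init_indic_half (2^-1 ^+ k * c) _ _ _.
  move=> H; suff : norm_sp E (init_indic (2^-1 ^+ k * c)) <=
    2 * norm_sp E (init_indic (2^-1 * (2^-1 ^+ k * c))) by lra.
  apply: H; first exact: mulr_gt0.
    by rewrite mulr_ile1// ltW.
  by rewrite mulrA -exprS; exact: Ek.
have nc := init_indic_norm_gt0 c0 c1 Ec.
rewrite -(ler_pM2r nc); apply: le_trans (low n) _.
by rewrite -dilation_init_indic//; exact: dilation_norm_le.
Qed.

Lemma lower_boyd_spec : 0 <= lower_boyd E /\
  forall s, 0 < s <= 1 -> s `^ lower_boyd E <= dilation_norm E s.
Proof.
apply: submultiplicative_index.
- exact: dilation_norm_gt0.
- exact: dilation_norm_le1.
- exact: dilation_norm_mul.
- exact: dilation_norm_half.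
Qed.

End dilation_norm.

(** * The multiplicator norm *)

Lemma lee_of_eq (R : realType) (a b : \bar R) : a = b -> (a <= b)%E.
Proof. by move=> ->. Qed.

Lemma distr1_ae_le (R : realType) (x y : R -> R) tau :
  measurable_fun (unit_itv R) x -> measurable_fun (unit_itv R) y ->
  {ae lebesgue_measure, forall u, unit_itv R u -> `|x u| <= `|y u|} ->
  (distr1 x tau <= distr1 y tau)%E.
Proof.
move=> mx my [A [mA A0 hA]]; rewrite /distr1 /distr_fun.
have mS (z : R -> R) : measurable_fun (unit_itv R) z ->
    measurable (unit_itv R `&` [set u | tau < `|z u|]).
  by move=> mz; apply: measurable_distr_set => //; exact: measurable_unit_itv.
rewrite -[leRHS](@measureU0 _ _ _ (@lebesgue_measure R) _ _ (mS _ my) mA A0).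
apply: le_measure; rewrite ?inE; [exact: mS|apply: measurableU => //; exact: mS|].
move=> u [Iu /= xu]; have [Au|Au] := pselect (A u); first by right.
left; split => //=; apply: lt_le_trans xu _; rewrite leNgt; apply/negP => yx.
by apply: Au; apply: hA => /= /(_ Iu); rewrite leNgt yx.
Qed.

Section multiplicator_bound.
Context {R : realType} (E : symmetric_space R) (x : R -> R).
Hypothesis Mx : multiplicator E x.
Implicit Types y z : R -> R.

(** The hypothesis says that a z dominates y in distribution; tensoring with x preserves this, and
    homogeneity takes a out of the norm. *)
Lemma norm_sp2_tensor_le y z (a : R) : mem_sp E y -> mem_sp E z -> 0 < a ->
  (forall tau, 0 < tau -> (distr1 y tau <= distr1 z (tau / a))%E) ->
  norm_sp2 E (tensor x y) <= a * norm_sp2 E (tensor x z).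
Proof.
move=> Ey Ez a0 yz; have [mx Mxy] := Mx.
have my := sp_measurable Ey; have mz := sp_measurable Ez.
have mxy := measurable_tensor mx my; have mxz := measurable_tensor mx mz.
have [_ Exz] := Mxy _ Ez.
have Eaz := sp_scale a Exz.
rewrite /norm_sp2 -[X in X * _](gtr0_norm a0) -norm_spZ//.
apply: (sp_dominated _ Eaz _).2; first by apply: measurable_rearr; exact: distr2_like.
move=> tau tau0.
have e1 := distr1_rearr (distr2_like mxy) tau0.
have e2 := distr1_rearr (distr2_like mxz) (divr_gt0 tau0 a0).
have e3 := distr1_scale (rearr2 (tensor x z)) tau a0.
have e4 := distr2_scaler x z tau a0.
have e5 := etrans e3 (etrans e2 (esym e4)).
apply: (@le_trans _ _ (distr2 (tensor x y) tau)); first by apply/lee_of_eq/e1.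
apply: (@le_trans _ _ (distr2 (tensor x (fun u => a * z u)) tau)); last by apply/lee_of_eq/esym/e5.
apply: distr2_tensor_mono => //; first exact: measurable_scale.
by move=> s s0; have -> := distr1_scale z s a0; exact: yz.
Qed.

Let pow2_gt0 k : 0 < (2 : R) ^+ k.
Proof. by rewrite exprn_gt0. Qed.

Let exprVn2 k : (2^-1 : R) ^+ k = (2 ^+ k)^-1.
Proof. by rewrite exprVn. Qed.

(* Gliding hump: if unit vectors y_k had |x (x) y_k| > 4 ^ k, the vector
   sum_k 2 ^ - k |y_k| of E would not be multiplied into E(I x I). *)
Lemma norm_mult_lty : (norm_mult E x < +oo)%E.
Proof.
rewrite ltey; apply/eqP => Noo.
have [y hy] : {y : nat -> R -> R & forall k, [/\ mem_sp E (y k), norm_sp E (y k) <= 1 &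
    4 ^+ k < norm_sp2 E (tensor x (y k))]}.
  apply: (@choice _ _ (fun k y => [/\ mem_sp E y, norm_sp E y <= 1 &
    4 ^+ k < norm_sp2 E (tensor x y)])) => k.
  have : ((4 ^+ k)%:E < norm_mult E x)%E by rewrite Noo ltry.
  by move=> /ereal_sup_gt[_ [y [Ey y1] <-]]; rewrite lte_fin => h; exists y.
have Ey k : mem_sp E (y k) by have [] := hy k.
have y1 k : norm_sp E (y k) <= 1 by have [] := hy k.
have yk k : 4 ^+ k < norm_sp2 E (tensor x (y k)) by have [] := hy k.
pose b k : R -> R := fun u => 2^-1 ^+ k * `|y k u|.
have Eb k : mem_sp E (b k) /\ norm_sp E (b k) <= 2^-1 ^+ k.
  have [En nn] : mem_sp E (fun u => `|y k u|) /\
      norm_sp E (fun u => `|y k u|) <= norm_sp E (y k).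
    apply: sp_ideal => //.
      exact: measurableT_comp (sp_measurable (Ey k)).
    by apply: aeW => u _; rewrite normr_id.
  split; first exact: sp_scale.
  rewrite norm_spZ// ger0_norm ?exprn_ge0 ?invr_ge0// ler_piMr ?exprn_ge0 ?invr_ge0//.
  exact: le_trans nn (y1 k).
pose f n : R -> R := fun u => \sum_(k < n) b k u.
have fS n : f n.+1 = f n \+ b n.
  by apply/funext => u; rewrite /f big_ord_recr.
have [E0 n0] := sp_zero E.
have Ef n : mem_sp E (f n).
  elim: n => [|n IH]; last by rewrite fS; apply: sp_add => //; exact: (Eb n).1.
  by rewrite (_ : f 0%N = fun=> 0)//; apply/funext => u; rewrite /f big_ord0.
have EN z : mem_sp E z -> mem_sp E (\- z) /\ norm_sp E (\- z) = norm_sp E z.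
  move=> Ez; have -> : \- z = (fun u => -1 * z u).
    by apply/funext => u /=; rewrite mulN1r.
  by split; [exact: sp_scale|rewrite norm_spZ// normrN1 mul1r].
have ED z w : mem_sp E z -> mem_sp E w -> mem_sp E (z \- w).
  by move=> Ez Ew; apply: (sp_add Ez); exact: (EN _ Ew).1.
(* The right-hand side is the exact sum of 2^-k over n <= k < n + j. *)
have tail n j : norm_sp E (f (n + j)%N \- f n) <= 2 * (2^-1 ^+ n - 2^-1 ^+ (n + j)).
  elim: j => [|j IH].
    rewrite addn0 subrr mulr0 (_ : _ \- _ = fun=> 0) ?n0//.
    by apply/funext => u /=; rewrite subrr.
  rewrite addnS fS (_ : _ \- _ = (f (n + j)%N \- f n) \+ b (n + j)%N); last first.
    by apply/funext => u /=; rewrite addrAC.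
  apply: le_trans (norm_spD (ED _ _ (Ef _) (Ef _)) (Eb _).1) _.
  have := (Eb (n + j)%N).2; rewrite exprS; lra.
have cauchy (e : R) : 0 < e -> exists N : nat, forall n m : nat,
    (N <= n)%N -> (N <= m)%N -> norm_sp E (f n \- f m) < e.
  move=> e0; pose N := Num.truncn (4 / e); exists N => n m Nn Nm.
  (* Two tails starting at N, each at most 2 * 2^-N, are added below. *)
  have hN : 4 * 2^-1 ^+ N < e.
    have : 4 / e < 2 ^+ N.
      apply: lt_le_trans (truncnS_gt _) _.
      by rewrite -natrX ler_nat; exact: ltn_expl.
    rewrite exprVn2 ltr_pdivrMr// -ltr_pdivrMl ?pow2_gt0// mulrC//.
  rewrite (_ : f n \- f m = (f n \- f N) \+ (\- (f m \- f N))); last first.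
    by apply/funext => u /=; ring.
  have Em := EN _ (ED _ _ (Ef m) (Ef N)).
  apply: le_lt_trans (norm_spD (ED _ _ (Ef n) (Ef N)) Em.1) _.
  rewrite Em.2.
  have := tail N (n - N)%N; have := tail N (m - N)%N; rewrite !subnKC//.
  have p1 : 0 <= (2^-1 : R) ^+ n by rewrite exprn_ge0// invr_ge0.
  have p2 : 0 <= (2^-1 : R) ^+ m by rewrite exprn_ge0// invr_ge0.
  lra.
have [z Ez fz] := sp_complete Ef cauchy.
have mz := sp_measurable Ez.
have bz k : {ae lebesgue_measure, forall u, unit_itv R u -> b k u <= z u}.
  pose d : R -> R := fun u => b k u - z u.
  (* The positive part of b k - z. For n > k the partial sum f n is at least b k, so w <= |f n - z|;
     letting n tend to infinity shows that w has norm 0. *)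
  pose w : R -> R := fun u => 2^-1 * (`|d u| + d u).
  have md : measurable_fun (unit_itv R) d.
    by apply: measurable_funB => //; exact: sp_measurable (Eb k).1.
  have mw : measurable_fun (unit_itv R) w.
    apply: measurable_scale; apply: measurable_funD => //.
    exact: measurableT_comp md.
  have wf n : (k < n)%N -> mem_sp E w /\ norm_sp E w <= norm_sp E (f n \- z).
    move=> kn; apply: sp_ideal => //; first exact: ED.
    apply: aeW => u _ /=.
    have : b k u <= f n u.
      rewrite /f (bigD1 (Ordinal kn))//= lerDl; apply: sumr_ge0 => i _.
      by rewrite mulr_ge0// exprn_ge0// invr_ge0.
    move=> bf; have := ler_norm (f n u - z u); have := normr_ge0 (f n u - z u).
    rewrite /w /d; case: (ger0P (b k u - z u)) => h ? ?; last first.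
      by rewrite addNr mulr0 normr0.
    rewrite ger0_norm; lra.
  have [Ew _] := wf k.+1 (ltnSn k).
  have w0 : norm_sp E w = 0.
    apply/eqP; rewrite eq_le norm_sp_ge0// andbT.
    rewrite leNgt; apply/negP => w0.
    have [M _ hM] := cvgr0_norm_lt _ fz _ w0.
    have := hM (maxn M k.+1) (leq_maxl _ _).
    rewrite /= ltNge => /negP; apply; apply: le_trans (ler_norm _).
    exact: (wf _ (leq_maxr M k.+1)).2.
  apply: (negligibleS _ (norm_sp_eq0 Ew w0)) => u /=; apply: contra_not => h /h; rewrite /w /d.
  case: (ger0P (b k u - z u)) => ? ?; lra.
(* Almost everywhere |y k| = 2^k b k <= 2^k z, so 4^k is less than 2^k times the norm of the product
   with z. *)
have big k : 2 ^+ k < norm_sp2 E (tensor x z).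
  rewrite -(ltr_pM2l (pow2_gt0 k)) -exprMn.
  have -> : (2 * 2 : R) = 4 by rewrite -natrM.
  apply: lt_le_trans (yk k) _; apply: norm_sp2_tensor_le => //.
  move=> tau tau0; rewrite -distr1_scale//.
  apply: distr1_ae_le; [exact: sp_measurable|exact: measurable_scale|].
  apply: (negligibleS _ (bz k)) => u /=; apply: contra_not => h /h; rewrite /b exprVn2 ler_pdivrMl//.
  rewrite normrM (gtr0_norm (pow2_gt0 k)) => h'; apply: le_trans h' _.
  by rewrite ler_pM2l// ler_norm.
have := big (Num.truncn (norm_sp2 E (tensor x z))); rewrite ltNge; case/negP.
apply: le_trans (ltW (truncnS_gt _)) _.
by rewrite -natrX ler_nat; exact: ltn_expl.
Qed.

Lemma norm_mult_fin : exists2 m : R, 0 <= m & norm_mult E x = m%:E.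
Proof.
have [E0 n0] := sp_zero E.
have N0 : (0 <= norm_mult E x)%E.
  apply: (@le_trans _ _ (norm_sp2 E (tensor x (fun=> 0)))%:E).
    by rewrite lee_fin; apply: norm_sp_ge0; have [_ Mxy] := Mx; exact: (Mxy _ E0).2.
  by apply: ereal_sup_ubound; exists (fun=> 0) => //=; rewrite n0.
exists (fine (norm_mult E x)); first exact: fine_ge0.
by rewrite fineK// ge0_fin_numE// norm_mult_lty.
Qed.

Lemma norm_sp2_tensor y m : norm_mult E x = m%:E -> 0 <= m -> mem_sp E y ->
  norm_sp2 E (tensor x y) <= m * norm_sp E y.
Proof.
move=> Nm m0 Ey; have y0 := norm_sp_ge0 Ey.
(* Dividing by some r above the norm also covers vectors of norm 0. The increment e / (m + 1)
   contributes at most e, even if m = 0. *)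
suff H r : norm_sp E y < r -> norm_sp2 E (tensor x y) <= m * r.
  apply/ler_addgt0Pr => e e0.
  have e1 : 0 < e / (m + 1) by rewrite divr_gt0// ltr_wpDl.
  apply: (le_trans (H (norm_sp E y + e / (m + 1)) _)); first by rewrite ltrDl.
  rewrite mulrDr lerD2l mulrCA ler_piMr ?(ltW e0)//.
  by rewrite ler_pdivrMr ?mul1r ?lerDl// ltr_wpDl.
move=> yr; have r0 : 0 < r by apply: le_lt_trans yr.
have Ey' := sp_scale r^-1 Ey.
apply: (le_trans (@norm_sp2_tensor_le y _ r Ey Ey' r0 _)).
  move=> tau tau0; rewrite distr1_scale ?invr_gt0//.
  by rewrite invrK divfK ?gt_eqF.
rewrite mulrC ler_pM2r// -lee_fin -Nm; apply: ereal_sup_ubound.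
exists (fun u => r^-1 * y u) => //=; split => //.
by rewrite norm_spZ// gtr0_norm ?invr_gt0// ler_pdivrMl// mulr1 ltW.
Qed.

End multiplicator_bound.

(** * Tensor powers *)

(** If S > T > 0, the exponentially growing (S / T)^n would stay below the linear d n + 1. *)
Lemma expr_le_poly_growth (R : realType) (S T : R) (d : nat) : 0 <= S -> 0 <= T ->
  (forall n, S ^+ n <= (d * n).+1%:R * T ^+ n) -> S <= T.
Proof.
move=> S0 T0 H; rewrite leNgt; apply/negP => TS.
have [T00|Tn0] := eqVneq T 0.
  by have := H 1%N; rewrite !expr1 T00 mulr0 leNgt -T00 TS.
have T1 : 0 < T by rewrite lt_neqAle eq_sym Tn0.
(* Bernoulli's inequality alone gives linear growth; applied to the square root and then squared, it
   gives quadratic growth. *)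
pose r := Num.sqrt (S / T).
have r2 : r ^+ 2 = S / T by rewrite sqr_sqrtr// divr_ge0.
have ST1 : 1 < S / T by rewrite ltr_pdivlMr// mul1r.
have r1 : 1 < r by rewrite -[ltLHS]sqrtr1 ltr_sqrt// (lt_trans ltr01).
have bern n : 1 + n%:R * (r - 1) <= r ^+ n.
  elim: n => [|n IH]; first by rewrite mul0r addr0 expr0.
  rewrite exprS -natr1; apply: (@le_trans _ _ (r * (1 + n%:R * (r - 1)))).
    have : 0 <= n%:R * (r - 1) * (r - 1).
      by rewrite !mulr_ge0// subr_ge0 ltW.
    lra.
  by rewrite ler_wpM2l//; lra.
have Hn n : (r ^+ n) ^+ 2 <= (d * n).+1%:R.
  by rewrite exprAC r2 expr_div_n ler_pdivrMr ?exprn_gt0.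
(* For this n the quadratic term n^2 (r - 1)^2 exceeds d n. *)
pose n := (Num.truncn (d%:R / (r - 1) ^+ 2)).+1.
have e2 : 0 < (r - 1) ^+ 2 by rewrite exprn_gt0// subr_gt0.
have hn : d%:R < n%:R * (r - 1) ^+ 2 by rewrite -ltr_pdivrMr// truncnS_gt.
have := Hn n; rewrite leNgt => /negP; apply.
have b2 : (1 + n%:R * (r - 1)) ^+ 2 <= (r ^+ n) ^+ 2.
  have r0 : 0 <= r by rewrite ltW// (lt_trans ltr01).
  apply: lerXn2r; rewrite ?nnegrE ?exprn_ge0//.
  by rewrite addr_ge0// mulr_ge0// subr_ge0 ltW.
apply: lt_le_trans b2; rewrite -natr1 natrM.
have n0 : 0 < (n%:R : R) by rewrite ltr0n.
have : 0 < n%:R * (r - 1) by rewrite mulr_gt0// subr_gt0.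
have : n%:R * d%:R < n%:R * (n%:R * (r - 1) ^+ 2) by rewrite ltr_pM2l.
set a := n%:R * (n%:R * (r - 1) ^+ 2).
have -> : (1 + n%:R * (r - 1)) ^+ 2 = 1 + 2 * (n%:R * (r - 1)) + a by rewrite /a; ring.
rewrite [d%:R * _]mulrC; lra.
Qed.

Section tensor_powers.
Context {R : realType} (E : symmetric_space R) (x : R -> R) (m : R).
Hypothesis Mx : multiplicator E x.
Hypothesis Nm : norm_mult E x = m%:E.
Hypothesis m0 : 0 <= m.
Variables (A : nat -> set R) (c : R) (d : nat).
Hypothesis c0 : 0 < c.
Hypothesis mA : forall j, measurable (A j).
Hypothesis tA : trivIset setT A.
Hypothesis AI : forall j, A j `<=` unit_itv R.
Hypothesis xA : forall j s, A j s -> c * 2 ^+ j <= `|x s|.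

Let t j := fine (lebesgue_measure (A j)).

Let A_le1 : (\sum_(j < d) lebesgue_measure (A j) <= 1)%E.
Proof.
rewrite -(@measure_bigsetU _ _ _ (@lebesgue_measure R) A mA tA d).
rewrite -(lebesgue_unit_itv R) le_measure ?inE//.
- by apply: bigsetU_measurable => j _; exact: mA.
- exact: measurable_unit_itv.
- by rewrite -bigcup_mkord => u [j _ Au]; exact: AI Au.
Qed.

Let tE j : lebesgue_measure (A j) = (t j)%:E.
Proof.
rewrite /t fineK// ge0_fin_numE//; apply: (@le_lt_trans _ _ 1%E); last exact: ltry.
rewrite -(lebesgue_unit_itv R) le_measure ?inE//.
  exact: mA.
exact: measurable_unit_itv.
Qed.

Let t_ge0 j : 0 <= t j.
Proof. by rewrite -lee_fin -tE. Qed.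

(** The coefficient of X^l in Q^n is the total measure of the products of n sets A_j, j < d, whose
    indices add up to l. *)
Let Q : {poly R} := \poly_(j < d) t j.

Let Qcoef_ge0 n l : 0 <= (Q ^+ n)`_l.
Proof.
elim: n l => [|n IH] l; first by rewrite expr0 coef1.
rewrite exprS coefM; apply: sumr_ge0 => j _; rewrite mulr_ge0//.
by rewrite coef_poly; case: ifP.
Qed.

(** Coefficients are nonnegative, so each is at most the value at 1, and Q(1) is the measure of a
    disjoint union inside I. The coefficients can thus serve as dilation parameters. *)
Let Qcoef_le1 n l : (Q ^+ n)`_l <= 1.
Proof.
have Q1 : 0 <= Q.[1] <= 1.
  rewrite horner_poly; apply/andP; split.
    by apply: sumr_ge0 => j _; rewrite expr1n mulr1.
  rewrite -lee_fin -sumEFin; apply: le_trans A_le1; apply: lee_sum => j _.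
  by rewrite expr1n mulr1 tE.
have /andP[Qa Qb] := Q1.
apply: (@le_trans _ _ (Q ^+ n).[1]); last by rewrite horner_exp exprn_ile1.
have [ls|ls] := ltnP l (size (Q ^+ n)); last first.
  by rewrite nth_default// horner_exp exprn_ge0.
rewrite horner_coef (bigD1 (Ordinal ls))//= expr1n mulr1 lerDl.
by apply: sumr_ge0 => i _; rewrite expr1n mulr1.
Qed.

(** Rearranging after each tensoring keeps the iterates on I and stands in for tensor powers on
    higher-dimensional cubes. *)
Let Y (y : R -> R) n := iter n (fun z => rearr2 (tensor x z)) y.

Let Y_mem y n : mem_sp E y ->
  mem_sp E (Y y n) /\ norm_sp E (Y y n) <= m ^+ n * norm_sp E y.
Proof.
move=> Ey; elim: n => [|n [En nn]]; first by rewrite expr0 mul1r.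
have [_ Mxy] := Mx; split; first exact: (Mxy _ En).2.
rewrite exprS -mulrA; apply: (@le_trans _ _ (m * norm_sp E (Y y n))).
  exact: norm_sp2_tensor.
by rewrite ler_wpM2l.
Qed.

(* Discarding all but one power of 2 avoids summing distribution functions. *)
Let Y_distr y n l tau : mem_sp E y -> 0 < tau ->
  (((Q ^+ n)`_l)%:E * distr1 y (tau / (c ^+ n * 2 ^+ l)) <= distr1 (Y y n) tau)%E.
Proof.
move=> Ey; have dy := distr1_like (sp_measurable Ey).
have [mx Mxy] := Mx.
elim: n l tau => [|n IH] l tau tau0.
  rewrite expr0 coef1; case: eqP => [->|_].
    by rewrite mul1e expr0 mulr1 divr1.
  by rewrite mul0e measure_ge0.
have [En _] := Y_mem n Ey; have mYn := sp_measurable En.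
have a0 j : 0 < c * 2 ^+ j by rewrite mulr_gt0// exprn_gt0.
(* The convolution formula for coefficient l of Q^(n+1) involves only j <= l, hence l + 1 sets.
   Those with j >= d enter it with coefficient 0, a valid lower bound for their measure. *)
have := @distr2_tensor_ge R x (Y y n) A (fun j => c * 2 ^+ j) l.+1 tau
  mx mYn mA tA AI a0 xA.
have e := distr1_rearr (distr2_like (measurable_tensor mx mYn)) tau0.
move=> H; apply: (@le_trans _ _ (distr2 (tensor x (Y y n)) tau)); last exact/lee_of_eq/esym/e.
apply: le_trans H.
rewrite exprS coefM -sumEFin ge0_sume_distrl; last first.
  move=> j _; rewrite lee_fin mulr_ge0// coef_poly; by case: ifP.
apply: lee_sum => j _.
have -> : tau / (c ^+ n.+1 * 2 ^+ l) = tau / (c * 2 ^+ j) / (c ^+ n * 2 ^+ (l - j)).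
  rewrite -{1}(subnKC (_ : j <= l)%N); last by rewrite -ltnS.
  rewrite exprS exprD; field.
  by rewrite !expf_neq0//= ?gt_eqF.
rewrite EFinM -muleA tE; apply: lee_pmul.
- by rewrite lee_fin coef_poly; case: ifP.
- by rewrite mule_ge0 ?lee_fin// (distr_ge0 dy).
- by rewrite lee_fin coef_poly; case: ifP.
- by apply: IH; rewrite divr_gt0.
Qed.

(** For y in the unit ball, [Y y n] has norm at most m^n and, by [Y_distr], dominates c^n 2^l times
    the dilation of y by the coefficient. *)
Lemma dilation_norm_tensor_power n l : 0 < (Q ^+ n)`_l ->
  c ^+ n * 2 ^+ l * dilation_norm E ((Q ^+ n)`_l) <= m ^+ n.
Proof.
set q := (Q ^+ n)`_l => q0; pose v := c ^+ n * 2 ^+ l.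
have v0 : 0 < v by rewrite mulr_gt0// exprn_gt0.
have q01 : 0 < q <= 1 by rewrite q0 Qcoef_le1.
have [E0 n0] := sp_zero E.
rewrite -/v -ler_pdivlMl//; apply: ge_sup.
  by exists (norm_sp E (dilation q (fun=> 0))), (fun=> 0) => //=; rewrite n0.
move=> _ [y [Ey y1] <-]; rewrite ler_pdivlMl//.
have [EY nY] := Y_mem n Ey.
apply: (@le_trans _ _ (m ^+ n * norm_sp E y)); last first.
  by rewrite ler_piMr// exprn_ge0.
apply: le_trans nY.
have [Edy _] := dilation_mem q01 Ey.
rewrite -[X in X * _](gtr0_norm v0) -norm_spZ//.
have Evdy := sp_scale v Edy.
apply: (sp_dominated _ EY _).2; first exact: sp_measurable Evdy.
move=> tau tau0; rewrite distr1_scale// distr1_dilation ?Qcoef_le1 ?divr_gt0//.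
  exact: Y_distr.
exact: sp_measurable Ey.
Qed.

Lemma sum_level_powers (p : R) : 0 < p -> lower_boyd E = p^-1 ->
  \sum_(j < d) (c * 2 ^+ j) `^ p * t j <= m `^ p.
Proof.
move=> p0 aE; have [_ Hlow] := lower_boyd_spec E.
(* The sum to be bounded is c^p Q(b), whose n-th power expands through the coefficients of Q^n. *)
pose b := (2 : R) `^ p.
have powX (u : R) n : 0 <= u -> (u ^+ n) `^ p = (u `^ p) ^+ n.
  move=> u0; elim: n => [|n IH]; first by rewrite !expr0 powR1.
  by rewrite !exprS powRM ?exprn_ge0// IH.
have b0 : 0 <= b by exact: powR_ge0.
have -> : \sum_(j < d) (c * 2 ^+ j) `^ p * t j = c `^ p * Q.[b].
  rewrite horner_poly big_distrr/=; apply: eq_bigr => j _.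
  rewrite powRM ?exprn_ge0 ?(ltW c0)// powX// -/b.
  by rewrite -mulrA; congr (_ * _); rewrite mulrC.
have Qb0 : 0 <= Q.[b].
  by rewrite horner_poly; apply: sumr_ge0 => j _; rewrite mulr_ge0// exprn_ge0.
apply: (@expr_le_poly_growth _ _ _ d); rewrite ?mulr_ge0 ?powR_ge0// => n.
rewrite exprMn -horner_exp horner_coef big_distrr/=.
have term l : (c `^ p) ^+ n * ((Q ^+ n)`_l * b ^+ l) <= (m `^ p) ^+ n.
  have [q0|q0] := eqVneq (Q ^+ n)`_l 0.
    by rewrite q0 mul0r mulr0 exprn_ge0// powR_ge0.
  have q1 : 0 < (Q ^+ n)`_l by rewrite lt_neqAle eq_sym q0 Qcoef_ge0.
  have v0 : 0 < c ^+ n * 2 ^+ l by rewrite mulr_gt0// exprn_gt0.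
  have qq : 0 < (Q ^+ n)`_l <= 1 by rewrite q1 Qcoef_le1.
  have H : c ^+ n * 2 ^+ l * (Q ^+ n)`_l `^ p^-1 <= m ^+ n.
    apply: le_trans (dilation_norm_tensor_power q1).
    by rewrite ler_wpM2l// ?(ltW v0)// -aE; exact: Hlow.
  have := @ge0_ler_powR _ p (ltW p0) _ _ _ _ H.
  rewrite !nnegrE mulr_ge0 ?powR_ge0 ?(ltW v0)// exprn_ge0// => /(_ isT isT).
  rewrite powRM ?powR_ge0 ?(ltW v0)// -powRrM mulVf ?gt_eqF// powRr1//.
  rewrite powRM ?exprn_ge0 ?(ltW c0)// !powX ?(ltW c0)// -/b.
  by rewrite -mulrA [b ^+ l * _]mulrC.
apply: (@le_trans _ _ (\sum_(l < size (Q ^+ n)) (m `^ p) ^+ n)).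
  by apply: ler_sum => l _; exact: term.
rewrite sumr_const card_ord -[leLHS]mulr_natl; apply: ler_wpM2r.
  by rewrite exprn_ge0// powR_ge0.
(* Q has at most d coefficients, hence Q^n has at most d n + 1. *)
rewrite ler_nat; apply: leq_trans (size_poly_exp_leq _ _) _.
rewrite ltnS leq_mul2r; apply/orP; right.
by apply: leq_trans (leq_pred _) _; exact: size_poly.
Qed.

End tensor_powers.

(** * Embedding into L_p *)

Lemma measurable_zero_ext (R : realType) (x : R -> R) :
  measurable_fun (unit_itv R) x -> measurable_fun setT (zero_ext x).
Proof.
move=> mx; have := (measurable_restrict x (@measurable_unit_itv R) measurableT).1.
rewrite setTI => /(_ mx); congr measurable_fun; apply/funext => u.
by rewrite patchE /zero_ext indicE; case: (u \in unit_itv R); rewrite ?mulr1 ?mulr0.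
Qed.

Lemma geometric_level (R : realType) (c v : R) d : c <= v -> v < c * 2 ^+ d ->
  exists2 j, (j < d)%N & c * 2 ^+ j <= v < c * 2 ^+ j.+1.
Proof.
move=> cv; elim: d => [|d IH]; first by rewrite expr0 mulr1 ltNge cv.
move=> vd; have [h|h] := ltP v (c * 2 ^+ d); last by exists d => //; rewrite h.
by have [j jd hj] := IH h; exists j => //; exact: ltnW.
Qed.

Section multiplicator_in_Lp.
Context {R : realType} (E : symmetric_space R) (x : R -> R) (m : R).
Hypothesis Mx : multiplicator E x.
Hypothesis Nm : norm_mult E x = m%:E.
Hypothesis m0 : 0 <= m.

Let mx : measurable_fun (unit_itv R) x := Mx.1.
Let mabs : measurable_fun (unit_itv R) (fun u => `|x u|).
Proof. exact: measurableT_comp mx. Qed.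

Lemma multiplicator_ae_bounded : lower_boyd E = 0 ->
  {ae lebesgue_measure, forall u, unit_itv R u -> `|x u| <= m}.
Proof.
move=> a0.
have mS s : measurable (unit_itv R `&` [set u | s < `|x u|]).
  by apply: measurable_distr_set => //; exact: measurable_unit_itv.
suff S0 : distr1 x m = 0%E.
  exists (unit_itv R `&` [set u | m < `|x u|]); split => //; first exact: mS.
  by move=> u /= /not_implyP[Iu] /negP; rewrite -ltNge.
apply: contrapT => /eqP h.
have : (0 < distr1 x m)%E by rewrite lt0e h (distr_ge0 (distr1_like mx)).
(* Right continuity yields s > m with |x| > s still on a set of positive measure. The power bound
   for this single set will give s <= m. *)
move=> /(distr_rc (distr1_like mx))[s ms hs].
pose A (j : nat) := if j == 0%N then unit_itv R `&` [set u | s < `|x u|] else set0.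
have s0 : 0 < s by apply: le_lt_trans ms.
have mA j : measurable (A j) by rewrite /A; case: ifP.
have tA : trivIset setT A.
  by move=> [|i] [|j] _ _ // [u []].
have AI j : A j `<=` unit_itv R by rewrite /A; case: ifP => // _ u [].
have xA j u : A j u -> s * 2 ^+ j <= `|x u|.
  by rewrite /A; case: eqP => // -> [_ /ltW]; rewrite expr0 mulr1.
have q0 : 0 < fine (lebesgue_measure (A 0%N)).
  rewrite fine_gt0// hs/=; apply: le_lt_trans (distr_le1 (distr1_like mx) s) _.
  exact: ltry.
have qE : ((\poly_(j < 1) fine (lebesgue_measure (A j))) ^+ 1)`_0 =
    fine (lebesgue_measure (A 0%N)) by rewrite expr1 coef_poly.
have := @dilation_norm_tensor_power R E x m Mx Nm m0 A s 1 s0 mA tA AI xA 1 0.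
rewrite qE !expr1 expr0 mulr1 => /(_ q0) H.
have [_ Hlow] := lower_boyd_spec E.
have q1 : 0 < fine (lebesgue_measure (A 0%N)) <= 1.
  rewrite q0 -lee_fin fineK; last first.
    rewrite ge0_fin_numE//; apply: le_lt_trans (distr_le1 (distr1_like mx) s) _.
    exact: ltry.
  exact: (distr_le1 (distr1_like mx) s).
have := Hlow _ q1; rewrite a0 powRr0 => N1.
have : s <= m by apply: le_trans H; rewrite ler_pMr.
by rewrite leNgt ms.
Qed.

Let level (c : R) (j : nat) : set R :=
  unit_itv R `&` [set u | c * 2 ^+ j <= `|x u| < c * 2 ^+ j.+1].

Let measurable_norm_itv (i : interval R) :
  measurable (unit_itv R `&` [set u | `|x u| \in i]).
Proof. exact: (mabs (@measurable_unit_itv R) (measurable_itv i)). Qed.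

Let measurable_level c j : measurable (level c j).
Proof.
have := measurable_norm_itv `[c * 2 ^+ j, c * 2 ^+ j.+1[.
by congr measurable; apply/seteqP; split => u /=; rewrite in_itv.
Qed.

Let trivIset_level c : 0 < c -> trivIset setT (level c).
Proof.
move=> c0 i j _ _ [u [[_ /= /andP[i1 i2]] [_ /= /andP[j1 j2]]]].
have H k l : c * 2 ^+ k <= `|x u| -> `|x u| < c * 2 ^+ l.+1 -> (k <= l)%N.
  move=> h1 h2; have := le_lt_trans h1 h2.
  by rewrite ltr_pM2l// ltr_eXn2l ?ltr1n.
by apply/eqP; rewrite eqn_leq (H i j)// (H j i).
Qed.

(** The upper bound is 2^K, written so that the 2 K dyadic levels starting at c = 2^-K cover the
    set. These truncations are needed because [sum_level_powers] handles finitely many levels above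
    a positive c. *)
Let F (K : nat) : set R :=
  unit_itv R `&` [set u | 2^-1 ^+ K <= `|x u| < 2^-1 ^+ K * 2 ^+ (K + K)].

Let measurable_F K : measurable (F K).
Proof.
have := measurable_norm_itv `[2^-1 ^+ K, 2^-1 ^+ K * 2 ^+ (K + K)[.
by congr measurable; apply/seteqP; split => u /=; rewrite in_itv.
Qed.

Let nondecreasing_F : nondecreasing_seq F.
Proof.
have E2 K : (2^-1 : R) ^+ K * 2 ^+ (K + K) = 2 ^+ K.
  by rewrite exprD mulrA -exprMn mulVf// expr1n mul1r.
move=> K L KL; rewrite subsetEset => u [Iu /=]; rewrite E2 => /andP[h1 h2].
split => //=; rewrite E2; apply/andP; split.
  by apply: le_trans h1; apply: ler_wiXn2l => //; lra.
by apply: lt_le_trans h2 _; apply: ler_weXn2l => //; rewrite ler1n.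
Qed.

Let bigcup_F : \bigcup_K F K = unit_itv R `&` [set u | x u != 0].
Proof.
apply/seteqP; split => [u [K _ [Iu /= /andP[h _]]]|u [Iu /= xu]].
  split => //=; rewrite -normr_gt0; apply: lt_le_trans h.
  by rewrite exprn_gt0// invr_gt0.
have xu0 : 0 < `|x u| by rewrite normr_gt0.
pose K := maxn (Num.truncn (`|x u|)) (Num.truncn (`|x u|^-1)).
have p2 n v : (n <= K)%N -> v < n.+1%:R -> v < (2 : R) ^+ K.
  move=> nK vn; apply: lt_le_trans vn _; rewrite -natrX ler_nat.
  by apply: leq_ltn_trans nK _; exact: ltn_expl.
exists K => //; split => //=; apply/andP; split.
  rewrite exprVn -[leRHS]invrK lef_pV2 ?posrE ?invr_gt0 ?exprn_gt0//.
  by apply/ltW/(p2 _ _ (leq_maxr _ _))/truncnS_gt.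
rewrite exprD mulrA -exprMn mulVf// expr1n mul1r.
exact: (p2 _ _ (leq_maxl _ _) (truncnS_gt _)).
Qed.

Let integral_F (p : R) K : 0 < p -> lower_boyd E = p^-1 ->
  (\int[lebesgue_measure]_(u in F K) (`|x u| `^ p)%:E <= ((2 * m) `^ p)%:E)%E.
Proof.
move=> p0 aE; pose c : R := 2^-1 ^+ K; pose d := (K + K)%N.
have c0 : 0 < c by rewrite exprn_gt0// invr_gt0.
have mp (D : set R) : measurable D -> D `<=` unit_itv R ->
    measurable_fun D (fun u => (`|x u| `^ p)%:E).
  move=> mD DI; apply/measurable_EFinP.
  apply: (measurableT_comp (measurable_powR _)).
  exact: (measurable_funS (@measurable_unit_itv R) DI mabs).
have DI : \big[setU/set0]_(0 <= j < d) level c j `<=` unit_itv R.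
  by rewrite big_mkord -bigcup_mkord => u [j _ []].
have mD : measurable (\big[setU/set0]_(0 <= j < d) level c j).
  by apply: bigsetU_measurable => j _; exact: measurable_level.
apply: (@le_trans _ _ (\int[lebesgue_measure]_(u in
    \big[setU/set0]_(0 <= j < d) level c j) (`|x u| `^ p)%:E)%E).
  apply: ge0_subset_integral => //.
  - exact: measurable_F.
  - exact: mp.
  move=> u [Iu /= /andP[h1 h2]]; rewrite big_mkord -bigcup_mkord.
  by have [j jd hj] := geometric_level h1 h2; exists j.
rewrite ge0_integral_bigsetU//; first last.
- exact: mp.
- by apply: sub_trivIset (trivIset_level c0).
- exact: iota_uniq.
- by move=> j; exact: measurable_level.
have lI j : level c j `<=` unit_itv R by move=> u [].
have lx j u : level c j u -> c * 2 ^+ j <= `|x u| by move=> [_ /= /andP[]].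
have H := @sum_level_powers R E x m Mx Nm m0 (level c) c d c0 (measurable_level c)
  (trivIset_level c0) lI lx p p0 aE.
have lfin j : lebesgue_measure (level c j) = (fine (lebesgue_measure (level c j)))%:E.
  rewrite fineK// ge0_fin_numE//; apply: (@le_lt_trans _ _ 1%E); last exact: ltry.
  rewrite -(lebesgue_unit_itv R) le_measure ?inE//.
    exact: measurable_level.
  exact: measurable_unit_itv.
rewrite powRM// EFinM; apply: (@le_trans _ _ ((2 `^ p)%:E *
    (\sum_(j < d) (c * 2 ^+ j) `^ p * fine (lebesgue_measure (level c j)))%:E)%E).
  rewrite big_mkord -EFinM big_distrr/= -sumEFin; apply: lee_sum => j _.
  (* On level j, |x| is below twice the lower bound c 2^j; this is the source of the factor 2^p. *)
  apply: (@le_trans _ _ (\int[lebesgue_measure]_(u in level c j)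
      (cst ((c * 2 ^+ j.+1) `^ p)%:E) u)%E).
    apply: ge0_le_integral => //.
    - exact: measurable_level.
    - by apply: mp; [exact: measurable_level|exact: lI].
    move=> u [_ /= /andP[_ h]]; rewrite lee_fin.
    apply: ge0_ler_powR; rewrite ?nnegrE// ?(ltW p0)//; last exact: ltW.
    by rewrite mulr_ge0 ?exprn_ge0 ?(ltW c0).
  rewrite integral_cst; last exact: measurable_level.
  rewrite [X in (_ * X <= _)%E](lfin j) -EFinM lee_fin mulrA -powRM//; last first.
    by rewrite mulr_ge0 ?exprn_ge0 ?(ltW c0).
  by rewrite mulrCA -exprS.
by rewrite lee_wpmul2l ?lee_fin ?powR_ge0.
Qed.

Lemma Lnorm_zero_ext_le : (Lp_unit_norm (boyd_exponent E) x <= (2 * m)%:E)%E.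
Proof.
have m2 : 0 <= 2 * m by rewrite mulr_ge0.
rewrite /Lp_unit_norm /boyd_exponent unlock /Lnorm.
have [a0|a0] := eqVneq (lower_boyd E) 0.
  (* For p = +oo the norm is an essential supremum if the whole space has positive measure, and 0
     otherwise. *)
  case: ifPn => _; last by rewrite lee_fin.
  apply/ess_supP; apply: (negligibleS _ (multiplicator_ae_bounded a0)) => u /=.
  apply: contra_not => h; rewrite lee_fin /zero_ext indicE.
  have [|_] := boolP (u \in unit_itv R); last by rewrite mulr0 normr0.
  by rewrite inE mulr1 => /h /le_trans; apply; rewrite ler_peMl// ler1n.
have [age0 _] := lower_boyd_spec E.
have p0 : 0 < (lower_boyd E)^-1 by rewrite invr_gt0 lt_neqAle eq_sym a0.
set p := (lower_boyd E)^-1 in p0 *.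
have aE : lower_boyd E = p^-1 by rewrite /p invrK.
have key : (\int[lebesgue_measure]_u `|(EFin \o zero_ext x) u| `^ p <=
    ((2 * m) `^ p)%:E)%E.
  pose g u := (`|x u| `^ p)%:E.
  (* Where the zero extension vanishes the integrand is 0^p = 0, so the integral lives on the union
     of the F K. Monotone convergence then carries the bound over from [integral_F]. *)
  have -> : (\int[lebesgue_measure]_u `|(EFin \o zero_ext x) u| `^ p =
      \int[lebesgue_measure]_(u in \bigcup_K F K) g u)%E.
    rewrite [RHS]integral_mkcond; apply: eq_integral => u _.
    rewrite patchE bigcup_F /g /= /zero_ext indicE.
    have [|h] := boolP (u \in _ `&` _).
      by rewrite inE => -[Iu _]; rewrite mem_set// mulr1.
    have -> : x u * (u \in unit_itv R)%:R = 0.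
      have [Iu|_] := boolP (u \in unit_itv R); last by rewrite mulr0.
      rewrite mulr1; apply/eqP; apply: contraNT h => xu; rewrite inE.
      by split => //; rewrite inE in Iu.
    by rewrite normr0 powR0// gt_eqF.
  have mF i : measurable_fun (F i) g.
    apply/measurable_EFinP; apply: (measurableT_comp (measurable_powR _)).
    apply: measurable_funS mabs; first exact: measurable_unit_itv.
    by move=> u [].
  have cF : (\int[lebesgue_measure]_(u in F i) g u @[i --> \oo] -->
      \int[lebesgue_measure]_(u in \bigcup_i F i) g u)%E.
    apply: ge0_nondecreasing_set_cvg_integral => //.
    by move=> i u _; rewrite lee_fin powR_ge0.
  apply: (cvge_le _ cF).
  by apply: nearW => K; exact: integral_F.
apply: (@le_trans _ _ (((2 * m) `^ p)%:E `^ p^-1)%E).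
  apply: gt0_ler_poweR => //.
  - by rewrite invr_ge0 ltW.
  - rewrite in_itv/= leey andbT; apply: integral_ge0 => u _.
    by rewrite lee_fin powR_ge0.
  - by rewrite in_itv/= leey andbT lee_fin powR_ge0.
by rewrite /= -powRrM mulfV ?gt_eqF// powRr1.
Qed.

End multiplicator_in_Lp.

Theorem theorem1p5 (R : realType) :
  exists C : R, 0 < C /\
    forall E : symmetric_space R,
      multiplicator E `<=` Lp_unit (boyd_exponent E) /\
      forall x : R -> R, multiplicator E x ->
        (Lp_unit_norm (boyd_exponent E) x <= C%:E * norm_mult E x)%E.
Proof.
exists 2; split => // E; split => [x Mx|x Mx].
  have [m m0 Nm] := norm_mult_fin Mx.
  rewrite /Lp_unit/= inE; apply/andP; split; rewrite inE/=.
    exact: measurable_zero_ext Mx.1.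
  rewrite /finite_norm; apply: le_lt_trans (Lnorm_zero_ext_le Mx Nm m0) _.
  exact: ltry.
have [m m0 Nm] := norm_mult_fin Mx.
by rewrite Nm -EFinM; exact: Lnorm_zero_ext_le.
Qed.
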